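(* For every positive integer $h$, there is a 1-2 drawing of the complete ternary tree $T_h$ that has minimum area among all planar straight-line orthogonal grid drawings of $T_h$ satisfying the subtree separation property.
   Context: $T_h$ denotes the complete ternary tree: every non-leaf node has exactly three children and every root-to-leaf path has exactly $h$ nodes. A planar straight-line orthogonal grid drawing maps nodes to distinct integer points and edges to horizontal or vertical segments, with no crossings; its width (height) is the number of vertical (horizontal) grid lines intersecting it, and its area is width times height. A subtree of a tree is either the whole tree or the subtree rooted at a non-root node $v$ (consisting of $v$ and all its descendants). A drawing has the subtree separation property if, for any two node-disjoint subtrees, the smallest axis-parallel rectangles enclosing their drawings do not overlap. 1-2 drawings of $T_h$ are defined recursively: for $h=1$, a single node at a grid point. For $h\ge2$, take any three (not necessarily congruent) 1-2 drawings $\Gamma^a,\Gamma^b,\Gamma^c$ of $T_{h-1}$ and combine them by Construction 1 or Construction 2. Construction 1: place the root $r$ of $T_h$ at a grid point; translate $\Gamma^a$ so that its topmost grid row is one unit below $r$ and its root is on the vertical line through $r$; rotate $\Gamma^b$ clockwise by $90^\circ$ and place it so its rightmost grid column is one unit left of the leftmost column of $\Gamma^a$, its root on the horizontal line through $r$; rotate $\Gamma^c$ counterclockwise by $90^\circ$ and place it so its leftmost column is one unit right of the rightmost column of $\Gamma^a$, its root on the horizontal line through $r$; connect $r$ to the three roots. Construction 2: place $r$; rotate $\Gamma^b$ clockwise by $90^\circ$ and place it so its rightmost column is one unit left of $r$, its root on the horizontal line through $r$; rotate $\Gamma^c$ counterclockwise by $90^\circ$ and place it so its leftmost column is one unit right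 of $r$, its root on the horizontal line through $r$; place $\Gamma^a$ so its topmost row is one unit below the lowest row intersecting $\Gamma^b$ or $\Gamma^c$, its root on the vertical line through $r$; connect $r$ to the three roots. *)

(* Defs.v *)
From mathcomp Require Import all_boot all_order all_algebra finmap.
From mathcomp Require Import boolp classical_sets cardinality set_interval reals.

Set Implicit Arguments.
Unset Strict Implicit.
Unset Printing Implicit Defensive.

Import Order.TTheory GRing.Theory Num.Theory.

Local Open Scope classical_set_scope.
Local Open Scope ring_scope.

(* A node of the complete ternary tree T_h is the word of child indices read
   on the path from the root; the root is [::] and the parent of rcons v i is
   v.  The path to v has (size v).+1 nodes, so T_h consists of the words of
   size < h.  The child indices only name the children: no definition below
   depends on their order. *)
Definition is_node (h : nat) (v : seq 'I_3) : bool := (size v < h)%N.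

(* Grid positions of the nodes.  As a drawing of T_h only the values on nodes
   of T_h matter.  The y-axis points upwards. *)
Definition drawing := seq 'I_3 -> int * int.

Definition subdrawing (D : drawing) (v : seq 'I_3) : drawing :=
  fun w => D (v ++ w).

Section Geometry.
Variable R : realType.

Definition grid_point (p : int * int) : R * R := (p.1%:~R, p.2%:~R).

Definition segment (p q : R * R) : set (R * R) :=
  [set z | exists2 t : R, 0 <= t <= 1 &
     z = (p.1 + t * (q.1 - p.1), p.2 + t * (q.2 - p.2))].

(* The edge from v to its child rcons v i; it belongs to T_h when rcons v i
   is a node of T_h. *)
Definition edge (D : drawing) (v : seq 'I_3) (i : 'I_3) : set (R * R) :=
  segment (grid_point (D v)) (grid_point (D (rcons v i))).

(* All points of the plane occupied by the nodes and edges of T_h. *)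
Definition drawn (h : nat) (D : drawing) : set (R * R) :=
  [set z | (exists2 v, is_node h v & z = grid_point (D v)) \/
           (exists v i, is_node h (rcons v i) /\ edge D v i z)].

Definition grid_columns (h : nat) (D : drawing) : set int :=
  [set x | exists y : R, drawn h D (x%:~R, y)].

Definition grid_rows (h : nat) (D : drawing) : set int :=
  [set y | exists x : R, drawn h D (x, y%:~R)].

(* fset_set is meaningful here because both sets are finite: the drawing is
   bounded, T_h having finitely many nodes. *)
Definition width (h : nat) (D : drawing) : nat := #|` fset_set (grid_columns h D)|.

Definition height (h : nat) (D : drawing) : nat := #|` fset_set (grid_rows h D)|.

Definition area (h : nat) (D : drawing) : nat := (width h D * height h D)%N.

Definition orthogonal (h : nat) (D : drawing) : Prop :=
  forall v i, is_node h (rcons v i) ->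
    (D v).1 = (D (rcons v i)).1 \/ (D v).2 = (D (rcons v i)).2.

(* Distinct edges meet only at common endpoints.  Since nodes have distinct
   positions, this also prevents an edge from passing through a node. *)
Definition crossing_free (h : nat) (D : drawing) : Prop :=
  forall u i v j, is_node h (rcons u i) -> is_node h (rcons v j) ->
    (u, i) <> (v, j) ->
    forall z, edge D u i z -> edge D v j z ->
    exists w, [/\ w \in [:: u; rcons u i], w \in [:: v; rcons v j]
                & z = grid_point (D w)].

Definition planar_orthogonal_grid_drawing (h : nat) (D : drawing) : Prop :=
  [/\ {in is_node h &, injective D}, orthogonal h D & crossing_free h D].

Definition axis_rectangle : set (set (R * R)) :=
  [set B | exists a b c d : R, B = `[a, b] `*` `[c, d]].

Definition enclosing_rectangle (h : nat) (D : drawing) (v : seq 'I_3) :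
    set (R * R) :=
  smallest axis_rectangle (drawn (h - size v) (subdrawing D v)).

Definition node_disjoint (h : nat) (u v : seq 'I_3) : Prop :=
  ~ exists w, [/\ is_node h w, prefix u w & prefix v w].

(* The rectangles are closed and possibly degenerate (a leaf gives a single
   point); not overlapping means having no common point. *)
Definition subtree_separation (h : nat) (D : drawing) : Prop :=
  forall u v, is_node h u -> is_node h v -> node_disjoint h u v ->
    enclosing_rectangle h D u `&` enclosing_rectangle h D v = set0.

Definition translate_of (h : nat) (A G : drawing) : Prop :=
  exists t : int * int, forall v, is_node h v ->
    A v = ((G v).1 + t.1, (G v).2 + t.2).

Definition rot_cw (G : drawing) : drawing := fun v => ((G v).2, - (G v).1).

Definition rot_ccw (G : drawing) : drawing := fun v => (- (G v).2, (G v).1).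

Definition is_max (S : set int) (m : int) : Prop := (S `&` ubound S) m.

Definition is_min (S : set int) (m : int) : Prop := (S `&` lbound S) m.

(* In both constructions r is the position of the root of T_h.+1, and A, B, C
   are the placed copies of Gamma^a, Gamma^b (rotated) and Gamma^c (rotated),
   as drawings of T_h. *)
Definition construction1 (h : nat) (r : int * int) (A B C : drawing) : Prop :=
  [/\ is_max (grid_rows h A) (r.2 - 1) /\ (A [::]).1 = r.1,
      (exists2 x, is_min (grid_columns h A) x
                & is_max (grid_columns h B) (x - 1)) /\ (B [::]).2 = r.2
    & (exists2 x, is_max (grid_columns h A) x
                & is_min (grid_columns h C) (x + 1)) /\ (C [::]).2 = r.2].

Definition construction2 (h : nat) (r : int * int) (A B C : drawing) : Prop :=
  [/\ is_max (grid_columns h B) (r.1 - 1) /\ (B [::]).2 = r.2,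
      is_min (grid_columns h C) (r.1 + 1) /\ (C [::]).2 = r.2
    & (exists2 y, is_min (grid_rows h B `|` grid_rows h C) y
                & is_max (grid_rows h A) (y - 1)) /\ (A [::]).1 = r.1].

(* The children a, b, c of the root carrying the three drawings may be chosen
   in any order. *)
Inductive drawing12 : nat -> drawing -> Prop :=
| Drawing12_single D : drawing12 1 D
| Drawing12_combine h (D Ga Gb Gc : drawing) (a b c : 'I_3) :
    drawing12 h Ga -> drawing12 h Gb -> drawing12 h Gc ->
    uniq [:: a; b; c] ->
    translate_of h (subdrawing D [:: a]) Ga ->
    translate_of h (subdrawing D [:: b]) (rot_cw Gb) ->
    translate_of h (subdrawing D [:: c]) (rot_ccw Gc) ->
    construction1 h (D [::]) (subdrawing D [:: a]) (subdrawing D [:: b])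
      (subdrawing D [:: c]) \/
    construction2 h (D [::]) (subdrawing D [:: a]) (subdrawing D [:: b])
      (subdrawing D [:: c]) ->
    drawing12 h.+1 D.

End Geometry.

(* Main.v *)
(* Let a 1-2 drawing use the same drawing B on both sides of its root.  If A and B have their roots
   in the middle column, widths 2 s_A + 1 and 2 s_B + 1 and heights h_A and h_B, then the result has
   the same symmetry, and its parameters (s, h) are (h_B + s_A, 1 + s_B + max(h_A, s_B)) for
   Construction 1 and (max(h_B, s_A), 1 + 2 s_B + h_A) for Construction 2.

   Conversely, take any drawing with the subtree separation property.  A planarity argument shows
   that a node other than the root of the whole tree never lies in the bounding box of the subtree
   of one of its children: its four directions are all in use, so its other edges, or those of its
   parent, wall in the subtrees of the child.  Rotate the drawing so that no child lies above the
   root; then the rectangles of the subtrees A (below), B (left) and C (right) are separated as in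
   Construction 1, as in Construction 2, or in a mixed way, and by induction one of the two
   constructions with (A, B, B) or (A, C, C) yields s at most the extents to the left and to the
   right of the root, and h at most the height.  If the root of the whole tree does lie in the box
   of a child, a case analysis using two different drawings for that child gives a symmetric 1-2
   drawing of no larger area, although in the last case not one of no larger width and height. *)
Require Import Defs.
From mathcomp Require Import all_boot all_order all_algebra finmap.
From mathcomp Require Import boolp classical_sets functions cardinality set_interval reals.
From mathcomp Require Import zify lra.

Set Implicit Arguments.
Unset Strict Implicit.
Unset Printing Implicit Defensive.

Import Order.TTheory GRing.Theory Num.Theory.

Local Open Scope ring_scope.

(** * Integer geometry and the induction *)

Definition lf (p q : int * int) : Prop := q.2 = p.2 /\ q.1 < p.1.
Definition rt (p q : int * int) : Prop := q.2 = p.2 /\ p.1 < q.1.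
Definition up (p q : int * int) : Prop := q.1 = p.1 /\ p.2 < q.2.
Definition dn (p q : int * int) : Prop := q.1 = p.1 /\ q.2 < p.2.

Definition samedir (p q q' : int * int) : Prop :=
  (lf p q /\ lf p q') \/ (rt p q /\ rt p q') \/
  (up p q /\ up p q') \/ (dn p q /\ dn p q').

Definition aligned (p q : int * int) : Prop := p.1 = q.1 \/ p.2 = q.2.

Definition pts (n : nat) (E : drawing) (z : int * int) : Prop :=
  exists2 w, (size w < n)%N & z = E w.

(* Disjointness of the bounding boxes of two nonempty sets of points. *)
Definition apart (P Q : int * int -> Prop) : Prop :=
  (forall p q, P p -> Q q -> p.1 < q.1) \/
  (forall p q, P p -> Q q -> q.1 < p.1) \/
  (forall p q, P p -> Q q -> p.2 < q.2) \/
  (forall p q, P p -> Q q -> q.2 < p.2).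

(** Each side must be attained, so the drawing determines the four numbers and disjointness of boxes
    can be tested on nodes. *)
Definition tbox (n : nat) (E : drawing) (l r d u : int) : Prop :=
  [/\ forall w, (size w < n)%N ->
        (l <= (E w).1 /\ (E w).1 <= r) /\ (d <= (E w).2 /\ (E w).2 <= u),
      (exists2 w, (size w < n)%N & (E w).1 = l) /\
        (exists2 w, (size w < n)%N & (E w).1 = r)
    & (exists2 w, (size w < n)%N & (E w).2 = d) /\
        (exists2 w, (size w < n)%N & (E w).2 = u)].

(* The second clause, the root lies outside the boxes of the child subtrees, is the only one that
   can fail under the subtree separation property. *)
Definition tame (m : nat) (E : drawing) : Prop :=
  [/\ forall i, aligned (E [::]) (E [:: i]),
      forall i, apart (pts 1 E) (pts m (subdrawing E [:: i])),
      forall i j, i <> j ->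
        apart (pts m (subdrawing E [:: i])) (pts m (subdrawing E [:: j])),
      forall i j, i <> j -> ~ samedir (E [::]) (E [:: i]) (E [:: j])
    & (1 < m)%N -> forall i j, ~ samedir (E [:: i]) (E [::]) (E [:: i; j])].

(** The first argument of [tame] counts the levels of the child subtrees, hence the predecessor. *)
Definition nice (n : nat) (E : drawing) : Prop :=
  forall w, ((size w).+1 < n)%N -> tame (n - size w).-1 (subdrawing E w).

(* ach n s h holds for the parameters (s, h) of the symmetric 1-2 drawings of T_n. *)
Inductive ach : nat -> nat -> nat -> Prop :=
| Ach1 : ach 1 0 1
| AchNarrow n sA hA sB hB : ach n sA hA -> ach n sB hB ->
    ach n.+1 (hB + sA) (1 + sB + maxn hA sB)
| AchWide n sA hA sB hB : ach n sA hA -> ach n sB hB ->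
    ach n.+1 (maxn hB sA) (1 + 2 * sB + hA).

(** * Symmetries of the grid fixing the origin *)

Definition swap (p : int * int) : int * int := (p.2, p.1).
Definition mirror (p : int * int) : int * int := (- p.1, p.2).

(** The two generators yield all symmetries of the square, and invariance has to be checked on them
    only. *)
Inductive dihedral : (int * int -> int * int) -> Prop :=
| DihId : dihedral id
| DihSwap g : dihedral g -> dihedral (fun p => swap (g p))
| DihMirror g : dihedral g -> dihedral (fun p => mirror (g p)).

Lemma iso_aligned g p q : dihedral g -> aligned p q -> aligned (g p) (g q).
Proof.
move=> ig H; elim: ig => [//|{}g _|{}g _]; rewrite /aligned /=; lia.
Qed.

Lemma samedir_swap p q q' :
  samedir (swap p) (swap q) (swap q') <-> samedir p q q'.
Proof. rewrite /samedir /lf /rt /up /dn /=; lia. Qed.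

Lemma samedir_mirror p q q' :
  samedir (mirror p) (mirror q) (mirror q') <-> samedir p q q'.
Proof. rewrite /samedir /lf /rt /up /dn /=; lia. Qed.

Lemma iso_samedir g p q q' : dihedral g ->
  samedir (g p) (g q) (g q') <-> samedir p q q'.
Proof.
by elim=> [//|{}g _ IH|{}g _ IH]; rewrite ?samedir_swap ?samedir_mirror.
Qed.

Lemma apart_swap n m E F :
  apart (pts n (swap \o E)) (pts m (swap \o F)) <-> apart (pts n E) (pts m F).
Proof.
split.
- case=> [H|[H|[H|H]]]; [do 2 right; left|do 3 right|left|right; left];
  move=> _ _ [w sw ->] [v sv ->];
  exact: H _ _ (ex_intro2 _ _ w sw erefl) (ex_intro2 _ _ v sv erefl).
- case=> [H|[H|[H|H]]]; [do 2 right; left|do 3 right|left|right; left];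
  move=> _ _ [w sw ->] [v sv ->];
  exact: H _ _ (ex_intro2 _ _ w sw erefl) (ex_intro2 _ _ v sv erefl).
Qed.

Lemma apart_mirror n m E F :
  apart (pts n (mirror \o E)) (pts m (mirror \o F)) <->
  apart (pts n E) (pts m F).
Proof.
split.
- case=> [H|[H|[H|H]]]; [right; left|left|do 2 right; left|do 3 right];
  move=> _ _ [w sw ->] [v sv ->];
  have := H _ _ (ex_intro2 _ _ w sw erefl) (ex_intro2 _ _ v sv erefl);
  rewrite /=; lia.
- case=> [H|[H|[H|H]]]; [right; left|left|do 2 right; left|do 3 right];
  move=> _ _ [w sw ->] [v sv ->];
  have := H _ _ (ex_intro2 _ _ w sw erefl) (ex_intro2 _ _ v sv erefl);
  rewrite /=; lia.
Qed.

Lemma iso_apart g n m E F : dihedral g ->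
  apart (pts n (g \o E)) (pts m (g \o F)) <-> apart (pts n E) (pts m F).
Proof.
elim=> [//|{}g _ IH|{}g _ IH].
- exact: iff_trans (apart_swap n m (g \o E) (g \o F)) IH.
- exact: iff_trans (apart_mirror n m (g \o E) (g \o F)) IH.
Qed.

Lemma iso_tame g m E : dihedral g -> tame m E -> tame m (g \o E).
Proof.
move=> ig [H1 H2 H3 H4 H5]; split.
- by move=> i; apply: iso_aligned.
- by move=> i; apply/(iso_apart 1 m E (subdrawing E [:: i]) ig).
- move=> i j ij.
  exact/(iso_apart m m (subdrawing E [:: i]) (subdrawing E [:: j]) ig)/H3.
- by move=> i j ij /(iso_samedir _ _ _ ig); apply: H4.
- by move=> m1 i j /(iso_samedir _ _ _ ig); apply: H5.
Qed.

Lemma iso_nice g n E : dihedral g -> nice n E -> nice n (g \o E).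
Proof. by move=> ig nE w hw; apply: (iso_tame ig (nE w hw)). Qed.

Lemma iso_swap : dihedral swap.
Proof. exact: (DihSwap DihId). Qed.

Lemma iso_mirror : dihedral mirror.
Proof. exact: (DihMirror DihId). Qed.

Lemma iso_swap_mirror : dihedral (swap \o mirror).
Proof. exact: (DihSwap iso_mirror). Qed.

(** * Bounding boxes *)

Lemma tbox_swap n E l r d u : tbox n E l r d u -> tbox n (swap \o E) d u l r.
Proof.
case=> H HX HY; split=> //.
by move=> w /H [].
Qed.

Lemma tbox_mirror n E l r d u :
  tbox n E l r d u -> tbox n (mirror \o E) (- r) (- l) d u.
Proof.
case=> H [[w1 s1 e1] [w2 s2 e2]] HY; split=> //.
- by move=> w /H; rewrite /=; lia.
- by split; [exists w2|exists w1]; rewrite //= (e1, e2).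
Qed.

Lemma tbox1 E : tbox 1 E (E [::]).1 (E [::]).1 (E [::]).2 (E [::]).2.
Proof.
split; [case=> //= _; lia|by split; exists [::]|by split; exists [::]].
Qed.

Lemma max_attained n (f : seq 'I_3 -> int) : (0 < n)%N ->
  exists2 m, forall w, (size w < n)%N -> f w <= m
           & exists2 w, (size w < n)%N & f w = m.
Proof.
elim: n f => // n IH f _; case: (posnP n) => [->|n0].
  by exists (f [::]); [case|exists [::]].
have [m0 H0 [w0 s0 e0]] := IH (fun w => f (ord0 :: w)) n0.
have [m1 H1 [w1 s1 e1]] := IH (fun w => f (inord 1 :: w)) n0.
have [m2 H2 [w2 s2 e2]] := IH (fun w => f (ord_max :: w)) n0.
have I3 (i : 'I_3) : [\/ i = ord0, i = inord 1 | i = ord_max].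
  case: i => [[|[|[|i]]] hi] //; [constructor 1|constructor 2|constructor 3];
  by apply: val_inj; rewrite /= ?inordK.
exists (Order.max (f [::]) (Order.max m0 (Order.max m1 m2))).
  case=> [|i w] /=; first lia.
  rewrite ltnS => sw.
  by case: (I3 i) => ->; [have := H0 w sw|have := H1 w sw|have := H2 w sw]; lia.
set M := Order.max _ _.
have [->|[->|[->|->]]] : M = f [::] \/ M = m0 \/ M = m1 \/ M = m2 by rewrite /M; lia.
- by exists [::].
- by exists (ord0 :: w0).
- by exists (inord 1 :: w1).
- by exists (ord_max :: w2).
Qed.

Lemma tbox_ex n E : (0 < n)%N -> exists l r d u, tbox n E l r d u.
Proof.
move=> n0.
have [r Hr [wr sr er]] := max_attained (fun w => (E w).1) n0.
have [l Hl [wl sl el]] := max_attained (fun w => - (E w).1) n0.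
have [u Hu [wu su eu]] := max_attained (fun w => (E w).2) n0.
have [d Hd [wd sd ed]] := max_attained (fun w => - (E w).2) n0.
exists (- l), r, (- d), u; split.
- move=> w sw; have := Hr w sw; have := Hl w sw; have := Hu w sw.
  have := Hd w sw; lia.
- by split; [exists wl; rewrite // -el opprK|exists wr].
- by split; [exists wd; rewrite // -ed opprK|exists wu].
Qed.

Lemma tbox_child n E i l r d u l' r' d' u' : tbox n.+1 E l r d u ->
  tbox n (subdrawing E [:: i]) l' r' d' u' ->
  [/\ l <= l', r' <= r, d <= d' & u' <= u].
Proof.
case=> H _ _ [_ [[w1 s1 <-] [w2 s2 <-]] [[w3 s3 <-] [w4 s4 <-]]].
have /H := s1 : (size (i :: w1) < n.+1)%N.
have /H := s2 : (size (i :: w2) < n.+1)%N.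
have /H := s3 : (size (i :: w3) < n.+1)%N.
have /H := s4 : (size (i :: w4) < n.+1)%N.
rewrite /subdrawing /=; split; lia.
Qed.

Lemma tbox_root n E l r d u : (0 < n)%N -> tbox n E l r d u ->
  [/\ l <= (E [::]).1, (E [::]).1 <= r, d <= (E [::]).2 & (E [::]).2 <= u].
Proof. by move=> n0 [/(_ [::] n0)] [[? ?] [? ?]]. Qed.

Lemma apart_tbox n m E F l r d u l' r' d' u' :
  apart (pts n E) (pts m F) -> tbox n E l r d u -> tbox m F l' r' d' u' ->
  r < l' \/ r' < l \/ u < d' \/ u' < d.
Proof.
move=> H [_ [[a1 b1 <-] [a2 b2 <-]] [[a3 b3 <-] [a4 b4 <-]]].
move=> [_ [[a5 b5 <-] [a6 b6 <-]] [[a7 b7 <-] [a8 b8 <-]]].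
have P1 w (h : (size w < n)%N) : pts n E (E w) by exists w.
have P2 w (h : (size w < m)%N) : pts m F (F w) by exists w.
by case: H => [|[|[|]]] H; [left|right; left|do 2 right; left|do 3 right];
  apply: H; auto.
Qed.

Lemma nice_child n E i : nice n.+1 E -> nice n (subdrawing E [:: i]).
Proof. by move=> nE w hw; apply: (nE (i :: w)). Qed.

Lemma nice_tame n E : (0 < n)%N -> nice n.+1 E -> tame n E.
Proof. by move=> n0 /(_ [::] n0). Qed.

(** * Lower bound when every root lies outside the boxes of its children *)

Definition noup (n : nat) (E : drawing) : Prop :=
  (1 < n)%N -> forall i, ~ up (E [::]) (E [:: i]).

(** Pigeonhole: [Q] and [S] take at most one index each, which leaves one of the three for [P]. *)
Lemma ord3_cover (P Q S : 'I_3 -> Prop) :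
  (forall i, P i \/ Q i \/ S i) ->
  (forall i j, i <> j -> ~ (Q i /\ Q j)) ->
  (forall i j, i <> j -> ~ (S i /\ S j)) -> exists i, P i.
Proof.
move=> C HQ HS.
pose a := ord0 : 'I_3; pose b := inord 1 : 'I_3; pose c := ord_max : 'I_3.
have ab : a <> b by move/(congr1 val); rewrite /= inordK.
have bc : b <> c by move/(congr1 val); rewrite /= inordK.
have ac : a <> c by [].
have := HQ _ _ ab; have := HQ _ _ bc; have := HQ _ _ ac.
have := HS _ _ ab; have := HS _ _ bc; have := HS _ _ ac.
case: (C a) => [|Ca]; first by exists a.
case: (C b) => [|Cb]; first by exists b.
case: (C c) => [|Cc]; first by exists c.
tauto.
Qed.

Lemma aligned_dir p q : aligned p q -> p <> q ->
  lf p q \/ rt p q \/ up p q \/ dn p q.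
Proof.
case: p q => [a b] [c d]; rewrite /aligned /lf /rt /up /dn /= => H ne.
have : ~ (a = c /\ b = d) by case=> e1 e2; case: ne; rewrite e1 e2.
lia.
Qed.

Lemma apart_root_neq m E i : (0 < m)%N ->
  apart (pts 1 E) (pts m (subdrawing E [:: i])) -> E [::] <> E [:: i].
Proof.
move=> m0 H e.
have P1 : pts 1 E (E [::]) by exists [::].
have P2 : pts m (subdrawing E [:: i]) (E [:: i]) by exists [::].
by case: H => [|[|[|]]] H; have := H _ _ P1 P2; rewrite e ltxx.
Qed.

Lemma tame_dir m E i : (0 < m)%N -> tame m E ->
  lf (E [::]) (E [:: i]) \/ rt (E [::]) (E [:: i]) \/
  up (E [::]) (E [:: i]) \/ dn (E [::]) (E [:: i]).
Proof.
by move=> m0 [H1 H2 _ _ _]; apply: aligned_dir => //; apply: apart_root_neq m0 _.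
Qed.

Lemma tame_kids m E : (0 < m)%N -> tame m E ->
  (forall i, ~ up (E [::]) (E [:: i])) ->
  exists a b c, [/\ dn (E [::]) (E [:: a]), lf (E [::]) (E [:: b]),
    rt (E [::]) (E [:: c]) & [/\ a <> b, a <> c & b <> c]].
Proof.
move=> m0 tE nu; have D i := tame_dir i m0 tE.
case: tE => [_ _ _ S _]; rewrite /samedir in S.
have [a Ha] : exists a, dn (E [::]) (E [:: a]).
  apply: (@ord3_cover _ (fun i => lf (E [::]) (E [:: i])) (fun i => rt (E [::]) (E [:: i]))).
  - by move=> i; have := D i; have := nu i; tauto.
  - by move=> i j ij; have := S _ _ ij; tauto.
  - by move=> i j ij; have := S _ _ ij; tauto.
have [b Hb] : exists a, lf (E [::]) (E [:: a]).
  apply: (@ord3_cover _ (fun i => dn (E [::]) (E [:: i])) (fun i => rt (E [::]) (E [:: i]))).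
  - by move=> i; have := D i; have := nu i; tauto.
  - by move=> i j ij; have := S _ _ ij; tauto.
  - by move=> i j ij; have := S _ _ ij; tauto.
have [c Hc] : exists a, rt (E [::]) (E [:: a]).
  apply: (@ord3_cover _ (fun i => dn (E [::]) (E [:: i])) (fun i => lf (E [::]) (E [:: i]))).
  - by move=> i; have := D i; have := nu i; tauto.
  - by move=> i j ij; have := S _ _ ij; tauto.
  - by move=> i j ij; have := S _ _ ij; tauto.
exists a, b, c; split=> //.
move: Ha Hb Hc; rewrite /dn /lf /rt.
by split=> e; subst; lia.
Qed.

(** The extents on the two sides of the root are bounded separately, because the induction step
    compares them with different subtrees. *)
Definition lower n := forall E l r d u,
  nice n E -> noup n E -> tbox n E l r d u ->
  exists s h, [/\ ach n s h, s%:Z <= (E [::]).1 - l, s%:Z <= r - (E [::]).1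
    & h%:Z <= u - d + 1].

(** Once the parent lies above the child, the edge between them occupies the upward direction. This
    makes the induction hypothesis applicable to the turned subtree. *)
Lemma noup_child g n E i : dihedral g ->
  ((1 < n)%N -> forall j, ~ samedir (E [:: i]) (E [::]) (E [:: i; j])) ->
  up (g (E [:: i])) (g (E [::])) -> noup n (g \o subdrawing E [:: i]).
Proof.
move=> ig H U n1 j V; case: (H n1 j).
by apply/(iso_samedir _ _ _ ig); rewrite /samedir; tauto.
Qed.

(* The suffixes a, b, c refer to the children below, to the left and to the right of the root. *)
Lemma lower_kids n E l r d u : (0 < n)%N -> lower n ->
  nice n.+1 E -> noup n.+1 E -> tbox n.+1 E l r d u ->
  let x := (E [::]).1 in let y := (E [::]).2 in
  exists b lb rb db ub, [/\ lf (E [::]) (E [:: b]),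
    tbox n (subdrawing E [:: b]) lb rb db ub &
  exists sA sB sC hA hB hC : nat, [/\ ach n sA hA, ach n sB hB, ach n sC hC &
  exists la ra da ua lc rc dc uc : int,
  [/\ [/\ ua < y, sA%:Z <= x - la, sA%:Z <= ra - x & hA%:Z <= ua - da + 1],
      [/\ rb < x, sB%:Z <= y - db, sB%:Z <= ub - y & hB%:Z <= rb - lb + 1],
      [/\ x < lc, sC%:Z <= y - dc, sC%:Z <= uc - y & hC%:Z <= rc - lc + 1],
      (rb < la \/ ua < db) /\ (ra < lc \/ ua < dc)
    & [/\ l <= la /\ ra <= r, d <= da, l <= lb /\ ub <= u, d <= db &
      [/\ rc <= r, d <= dc & uc <= u]]]]].
Proof.
move=> n0 IH nE nu tE x y.
have tm := nice_tame n0 nE.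
have [a [b [c [Da Lb Rc [ab ac bc]]]]] := tame_kids n0 tm (nu n0).
have TS i : (1 < n)%N -> forall j, ~ samedir (E [:: i]) (E [::]) (E [:: i; j]).
  by case: tm => _ _ _ _ H n1; apply: H.
have [la [ra [da [ua ta]]]] := tbox_ex (subdrawing E [:: a]) n0.
have [lb [rb [db [ub tb]]]] := tbox_ex (subdrawing E [:: b]) n0.
have [lc [rc [dc [uc tc]]]] := tbox_ex (subdrawing E [:: c]) n0.
have [sA [hA [aA A1 A2 A3]]] := IH _ _ _ _ _ (nice_child a nE)
  (@noup_child id n E a DihId (TS a) ltac:(move: Da; rewrite /up /dn; lia)) ta.
(* The side subtrees are turned so that their parent comes to lie above them; hence [sB] and [sC]
   are bounded by vertical extents, [hB] and [hC] by widths. *)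
have [sB [hB [aB B1 B2 B3]]] := IH _ _ _ _ _
  (iso_nice iso_swap (nice_child b nE))
  (@noup_child _ n E b iso_swap (TS b) ltac:(move: Lb; rewrite /up /lf /=; lia))
  (tbox_swap tb).
have [sC [hC [aC C1 C2 C3]]] := IH _ _ _ _ _
  (iso_nice iso_swap_mirror (nice_child c nE))
  (@noup_child _ n E c iso_swap_mirror (TS c) ltac:(move: Rc; rewrite /up /rt /=; lia))
  (tbox_swap (tbox_mirror tc)).
case: (tm) => _ T2 T3 _ _.
have Sa := apart_tbox (T2 a) (tbox1 E) ta.
have Sb := apart_tbox (T2 b) (tbox1 E) tb.
have Sc := apart_tbox (T2 c) (tbox1 E) tc.
have Sab := apart_tbox (T3 _ _ ab) ta tb.
have Sac := apart_tbox (T3 _ _ ac) ta tc.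
have [Ua1 Ua2 Ua3 Ua4] := tbox_child tE ta.
have [Ub1 Ub2 Ub3 Ub4] := tbox_child tE tb.
have [Uc1 Uc2 Uc3 Uc4] := tbox_child tE tc.
have [Ra1 Ra2 Ra3 Ra4] := tbox_root n0 ta.
have [Rb1 Rb2 Rb3 Rb4] := tbox_root n0 tb.
have [Rc1 Rc2 Rc3 Rc4] := tbox_root n0 tc.
move: Da Lb Rc A1 A2 A3 B1 B2 B3 C1 C2 C3 Sa Sb Sc Sab Sac.
move: Ra1 Ra2 Ra3 Ra4 Rb1 Rb2 Rb3 Rb4 Rc1 Rc2 Rc3 Rc4.
rewrite -/x -/y /subdrawing /dn /lf /rt /= => *.
exists b, lb, rb, db, ub; split=> //.
exists sA, sB, sC, hA, hB, hC; split=> //.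
exists la, ra, da, ua, lc, rc, dc, uc.
(* The box of [a] meets the column of the root and the boxes of [b] and [c] meet its row, which
   excludes two of the four ways of separating [a] from each of them. *)
split; [split; lia|split; lia|split; lia|lia|split; try lia; split; lia].
Qed.

Lemma lowerP n : (0 < n)%N -> lower n.
Proof.
elim: n => // n IH _ E l r d u; case: (posnP n) => [->|n0] nE nu tE.
  have [? ? ? ?] := tbox_root (ltn0Sn 0) tE.
  by exists 0%N, 1%N; split; [exact: Ach1|lia|lia|lia].
have [b [lb [rb [db [ub [_ _ K]]]]]] := lower_kids n0 (IH n0) nE nu tE.
case: K => sA [sB [sC [hA [hB [hC [aA aB aC K]]]]]].
case: K => la [ra [da [ua [lc [rc [dc [uc K]]]]]]].
case: K => -[A1 A2 A3 A4] [B1 B2 B3 B4] [C1 C2 C3 C4] [SB SC].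
case=> -[U1 U2] U3 [U4 U5] U6 [U7 U8 U9].
(* Horizontal separation on a side leaves room for Construction 1 there, vertical separation for
   Construction 2. If both sides agree, the side subtree with the smaller [h] is doubled. *)
have [rl|ul] := SB; have [rl'|ul'] := SC.
- case: (leqP hB hC) => hBC.
  + exists (hB + sA)%N, (1 + sB + maxn hA sB)%N; split; [exact: AchNarrow|lia|lia|lia].
  + exists (hC + sA)%N, (1 + sC + maxn hA sC)%N; split; [exact: AchNarrow|lia|lia|lia].
(* The left side offers [hB + sA] columns and the right side [maxn hC sA]. The comparison decides
   whether Construction 2 with [C] fits on the left or Construction 1 with [B] on the right; the
   next case is its mirror image. *)
- case: (leqP hC (hB + sA)) => hBC.
  + exists (maxn hC sA)%N, (1 + 2 * sC + hA)%N; split; [exact: AchWide|lia|lia|lia].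
  + exists (hB + sA)%N, (1 + sB + maxn hA sB)%N; split; [exact: AchNarrow|lia|lia|lia].
- case: (leqP hB (hC + sA)) => hBC.
  + exists (maxn hB sA)%N, (1 + 2 * sB + hA)%N; split; [exact: AchWide|lia|lia|lia].
  + exists (hC + sA)%N, (1 + sC + maxn hA sC)%N; split; [exact: AchNarrow|lia|lia|lia].
- case: (leqP hB hC) => hBC.
  + exists (maxn hB sA)%N, (1 + 2 * sB + hA)%N; split; [exact: AchWide|lia|lia|lia].
  + exists (maxn hC sA)%N, (1 + 2 * sC + hA)%N; split; [exact: AchWide|lia|lia|lia].
Qed.

(* Both sides get the drawing of b, whatever the drawing of the right child. *)
Lemma lower_left n E l r d u b lb rb db ub : (0 < n)%N ->
  nice n.+1 E -> noup n.+1 E -> tbox n.+1 E l r d u ->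
  lf (E [::]) (E [:: b]) -> tbox n (subdrawing E [:: b]) lb rb db ub ->
  exists s h, [/\ ach n.+1 s h, s%:Z <= (E [::]).1 - l & h%:Z <= ub - d + 1].
Proof.
move=> n0 nE nu tE Lb tb.
have [b' [lb' [rb' [db' [ub' [Lb' tb' K]]]]]] := lower_kids n0 (lowerP n0) nE nu tE.
have eb : b' = b.
  apply/eqP/negPn/negP => /eqP; case: (nice_tame n0 nE) => _ _ _ S _ /S.
  by rewrite /samedir; tauto.
subst b'.
have eub : ub' <= ub.
  by case: tb tb' => H _ _ [_ _ [_ [w sw <-]]]; have := H w sw; lia.
case: K => sA [sB [sC [hA [hB [hC [aA aB aC K]]]]]].
case: K => la [ra [da [ua [lc [rc [dc [uc K]]]]]]].
case: K => -[A1 A2 A3 A4] [B1 B2 B3 B4] [C1 C2 C3 C4] [SB SC].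
case=> -[U1 U2] U3 [U4 U5] U6 [U7 U8 U9].
have [rl|ul] := SB.
- exists (hB + sA)%N, (1 + sB + maxn hA sB)%N; split; [exact: AchNarrow|lia|lia].
- exists (maxn hB sA)%N, (1 + 2 * sB + hA)%N; split; [exact: AchWide|lia|lia].
Qed.

(** * Walls *)

(** The box spanned by [p] and [q], which is the segment between them when they are aligned. *)
Definition onseg (z p q : int * int) : Prop :=
  ((p.1 <= z.1 /\ z.1 <= q.1) \/ (q.1 <= z.1 /\ z.1 <= p.1)) /\
  ((p.2 <= z.2 /\ z.2 <= q.2) \/ (q.2 <= z.2 /\ z.2 <= p.2)).

(** Integer form of planarity with subtree separation; [good_of_planar] and [planar_of_good] prove
    the equivalence. *)
Record good (H : nat) (D : drawing) : Prop := Good {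
  good_inj : forall v w, (size v < H)%N -> (size w < H)%N -> D v = D w -> v = w;
  good_aligned : forall v i, ((size v).+1 < H)%N -> aligned (D v) (D (rcons v i));
  good_noncross : forall u i v j, ((size u).+1 < H)%N -> ((size v).+1 < H)%N ->
    (u, i) <> (v, j) -> forall z, onseg z (D u) (D (rcons u i)) ->
    onseg z (D v) (D (rcons v j)) ->
    exists w : seq 'I_3, [/\ w \in [:: u; rcons u i], w \in [:: v; rcons v j] & z = D w];
  good_apart : forall u v, (size u < H)%N -> (size v < H)%N ->
    ~~ prefix u v -> ~~ prefix v u ->
    apart (pts (H - size u) (subdrawing D u)) (pts (H - size v) (subdrawing D v)) }.

Lemma onsegC z p q : onseg z p q <-> onseg z q p.
Proof. rewrite /onseg; tauto. Qed.

Lemma onseg_l p q : onseg p p q.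
Proof. rewrite /onseg; lia. Qed.

Lemma onseg_r p q : onseg q p q.
Proof. rewrite /onseg; lia. Qed.

Lemma samedir_onseg p q q' : samedir p q q' -> onseg q p q' \/ onseg q' p q.
Proof. rewrite /samedir /onseg /lf /rt /up /dn; lia. Qed.

Lemma swapK p : swap (swap p) = p.
Proof. by case: p. Qed.

Lemma mirrorK p : mirror (mirror p) = p.
Proof. by case: p => a b; rewrite /mirror /= opprK. Qed.

Lemma onseg_swap z p q : onseg (swap z) (swap p) (swap q) <-> onseg z p q.
Proof. rewrite /onseg /=; tauto. Qed.

Lemma onseg_mirror z p q : onseg (mirror z) (mirror p) (mirror q) <-> onseg z p q.
Proof. rewrite /onseg /=; lia. Qed.

Lemma good_swap H D : good H D -> good H (swap \o D).
Proof.
case=> G1 G2 G3 G4; split.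
- by move=> v w sv sw /(congr1 swap); rewrite /= !swapK; apply: G1.
- by move=> v i sv; apply: (iso_aligned iso_swap); apply: G2.
- move=> u i v j su sv ne z; rewrite -(swapK z) => /onseg_swap z1 /onseg_swap z2.
  by have [w [w1 w2 ->]] := G3 _ _ _ _ su sv ne _ z1 z2; exists w.
- by move=> u v su sv uv vu; apply/(iso_apart _ _ _ _ iso_swap); apply: G4.
Qed.

Lemma good_mirror H D : good H D -> good H (mirror \o D).
Proof.
case=> G1 G2 G3 G4; split.
- by move=> v w sv sw /(congr1 mirror); rewrite /= !mirrorK; apply: G1.
- by move=> v i sv; apply: (iso_aligned iso_mirror); apply: G2.
- move=> u i v j su sv ne z; rewrite -(mirrorK z) => /onseg_mirror z1 /onseg_mirror z2.
  by have [w [w1 w2 ->]] := G3 _ _ _ _ su sv ne _ z1 z2; exists w.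
- by move=> u v su sv uv vu; apply/(iso_apart _ _ _ _ iso_mirror); apply: G4.
Qed.

Lemma iso_good g H D : dihedral g -> good H D -> good H (g \o D).
Proof.
by move=> ig gD; elim: ig => [//|{}g _ IH|{}g _ IH]; [exact: good_swap IH|exact: good_mirror IH].
Qed.

Lemma good_neq H D v w : good H D -> (size v < H)%N -> (size w < H)%N ->
  size v <> size w -> D v <> D w.
Proof. by move=> gD sv sw ne e; apply: ne; rewrite (good_inj gD sv sw e). Qed.

(** Otherwise the nearer child would lie on the edge to the farther one without being an end of
    it. *)
Lemma good_sibling_dir H D v i j : good H D -> ((size v).+1 < H)%N -> i <> j ->
  ~ samedir (D v) (D (rcons v i)) (D (rcons v j)).
Proof.
move=> gD sv ij /samedir_onseg.
have ne : (v, i) <> (v, j) by case.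
have K k k' : k <> k' -> rcons v k \notin [:: v; rcons v k'].
  move=> kk; rewrite !inE negb_or; apply/andP; split; apply/eqP.
    by move/(congr1 size); rewrite size_rcons; lia.
  by move/rcons_inj => -[].
case=> z.
- have [w [_ w2 e]] := good_noncross gD sv sv ne (onseg_r _ _) z.
  have ew := good_inj gD (v := rcons v i) (w := w).
  have : rcons v i = w.
    apply: ew => //; first by rewrite size_rcons.
    by move: w2; rewrite !inE => /orP[] /eqP ->; rewrite ?size_rcons // ltnW.
  by move=> ew'; move: w2; rewrite -ew' (negPf (K _ _ ij)).
- have [w [w1 _ e]] := good_noncross gD sv sv ne z (onseg_r _ _).
  have : rcons v j = w.
    apply: (good_inj gD) => //; first by rewrite size_rcons.
    by move: w1; rewrite !inE => /orP[] /eqP ->; rewrite ?size_rcons // ltnW.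
  by move=> ew'; move: w1; rewrite -ew' (negPf (K _ _ (nesym ij))).
Qed.

Lemma good_parent_dir H D q i j : good H D -> ((size q).+2 < H)%N ->
  ~ samedir (D (rcons q i)) (D q) (D (rcons (rcons q i) j)).
Proof.
move=> gD sq /samedir_onseg.
have sq1 : ((size q).+1 < H)%N by lia.
have sq2 : ((size (rcons q i)).+1 < H)%N by rewrite size_rcons.
have ne : (q, i) <> (rcons q i, j).
  by case=> /(congr1 size); rewrite size_rcons; lia.
case=> z.
- have [w [w1 w2 e]] := good_noncross gD sq1 sq2 ne (onseg_l _ _) z.
  have : q = w.
    apply: (good_inj gD) => //; first lia.
    by move: w1; rewrite !inE => /orP[] /eqP ->; rewrite ?size_rcons //; lia.
  move=> ew'; move: w2; rewrite -ew' !inE => /orP[] /eqP /(congr1 size);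
  rewrite !size_rcons; lia.
- have [w [w1 w2 e]] := good_noncross gD sq1 sq2 ne ((onsegC _ _ _).1 z) (onseg_r _ _).
  have : rcons (rcons q i) j = w.
    apply: (good_inj gD) => //; first by rewrite !size_rcons.
    by move: w1; rewrite !inE => /orP[] /eqP ->; rewrite ?size_rcons //; lia.
  move=> ew'; move: w1; rewrite -ew' !inE => /orP[] /eqP /(congr1 size);
  rewrite !size_rcons; lia.
Qed.

Lemma good_dir H D v i : good H D -> ((size v).+1 < H)%N ->
  lf (D v) (D (rcons v i)) \/ rt (D v) (D (rcons v i)) \/
  up (D v) (D (rcons v i)) \/ dn (D v) (D (rcons v i)).
Proof.
move=> gD sv; apply: aligned_dir; first exact: good_aligned gD _ _ sv.
by apply: (good_neq gD); rewrite ?size_rcons; lia.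
Qed.

(** The depths of the two edges differ by at least two, so they share no endpoint. *)
Lemma good_nocross H D u i v j z : good H D -> ((size u).+1 < H)%N ->
  ((size v).+1 < size u)%N -> onseg z (D u) (D (rcons u i)) ->
  onseg z (D v) (D (rcons v j)) -> False.
Proof.
move=> gD su vu z1 z2.
have ne : (u, i) <> (v, j) by case=> e; move: vu; rewrite e; lia.
have [||w [w1 w2 _]] := good_noncross gD _ _ ne z1 z2; [lia|lia|].
have : (size u <= size w)%N.
  by move: w1; rewrite !inE => /orP[] /eqP ->; rewrite ?size_rcons.
have : (size w <= (size v).+1)%N.
  by move: w2; rewrite !inE => /orP[] /eqP ->; rewrite ?size_rcons.
lia.
Qed.

Lemma subtree_stay H (D : drawing) x (P : int * int -> Prop) : P (D x) ->
  (forall w i, ((size (x ++ w)).+1 < H)%N -> P (D (x ++ w)) ->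
     P (D (rcons (x ++ w) i))) ->
  forall w, (size (x ++ w) < H)%N -> P (D (x ++ w)).
Proof.
move=> P0 PS; elim/last_ind => [|w i IH]; first by rewrite cats0.
rewrite -rcons_cat size_rcons => sw; apply: PS => //.
by apply: IH; apply: ltnW.
Qed.

Definition inrow (H : nat) (D : drawing) (z : int * int) (m : nat) : Prop :=
  exists v j, ((size v).+1 < m)%N /\ onseg z (D v) (D (rcons v j)).

(* A horizontal wall made of edges closer to the root confines the subtree. *)
Lemma row_barrier H D x (lx rx k : int) : good H D -> (D x).2 < k ->
  (forall w, (size (x ++ w) < H)%N -> lx < (D (x ++ w)).1 /\ (D (x ++ w)).1 < rx) ->
  (forall z : int * int, z.2 = k -> lx < z.1 -> z.1 < rx -> inrow H D z (size x)) ->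
  forall w, (size (x ++ w) < H)%N -> (D (x ++ w)).2 < k.
Proof.
move=> gD x0 X B; apply: (subtree_stay (P := fun z => z.2 < k)) => // w i sw Pw.
rewrite ltNge; apply/negP => ge.
have al := good_aligned gD i sw.
have [X1 X2] := X w (ltnW sw).
(* An edge leaving the half-plane is vertical and meets row [k] in its own column, at a point of the
   wall. *)
have [|//|//|v [j [sv zv]]] := B ((D (x ++ w)).1, k).
  by [].
apply: (good_nocross gD sw _ _ zv (i := i)).
- by rewrite size_cat; lia.
- have al2 : (D (x ++ w)).1 = (D (rcons (x ++ w) i)).1.
    case: al => // e; lia.
  rewrite /onseg /=; lia.
Qed.

Lemma pts_sub H D v w : (size (v ++ w) < H)%N ->
  pts (H - size v) (subdrawing D v) (D (v ++ w)).
Proof. by rewrite size_cat => s; exists w => //; lia. Qed.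

Lemma pts_root H D v : (size v < H)%N ->
  pts (H - size v) (subdrawing D v) (D v).
Proof. by move=> s; have := @pts_sub H D v [::]; rewrite cats0; apply. Qed.

Lemma good_apart_branch H D p i s i' t : good H D -> i <> i' ->
  (size (p ++ i :: s) < H)%N -> (size (p ++ i' :: t) < H)%N ->
  apart (pts (H - size (p ++ i :: s)) (subdrawing D (p ++ i :: s)))
        (pts (H - size (p ++ i' :: t)) (subdrawing D (p ++ i' :: t))).
Proof.
move=> gD /eqP ii s1 s2; apply: good_apart => //.
  by rewrite prefix_catr //= (negPf ii) andbF.
by rewrite prefix_catr //= eq_sym (negPf ii) andbF.
Qed.

(** The subtrees of [r] and [w] are apart, and their roots leave two cases. Either that of [r] lies
    to the right of [w], and the edge from [p] to [w] is a wall for [x], or it lies below [w], hence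
    below the row of [p]. *)
Lemma left_wall H D p i j i' : good H D -> ((size p).+2 < H)%N ->
  let r := rcons p i in let x := rcons r j in let w := rcons p i' in
  dn (D p) (D r) -> lf (D r) (D x) -> lf (D p) (D w) ->
  (forall t, (size (x ++ t) < H)%N -> (D (x ++ t)).1 < (D r).1) ->
  forall t, (size (x ++ t) < H)%N -> (D (x ++ t)).2 < (D p).2.
Proof.
move=> gD sp r x w Dr Lx Lw Xr.
have sx : size x = (size p).+2 by rewrite !size_rcons.
have sr : (size r < H)%N by rewrite !size_rcons; lia.
have sw : (size w < H)%N by rewrite !size_rcons; lia.
have ii : i' <> i.
  by move=> e; move: Dr Lw; rewrite /r /w e /dn /lf; lia.
have := @good_apart_branch H D p i' [::] i [::] gD ii.
rewrite !cats1 -/r -/w => /(_ sw sr).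
have Pw := pts_root D sw; have Pr := pts_root D sr.
have Px t : (size (x ++ t) < H)%N -> pts (H - size r) (subdrawing D r) (D (x ++ t)).
  by rewrite /x cat_rcons; apply: pts_sub.
move: Dr Lx Lw; rewrite /dn /lf => -[Dr1 Dr2] [Lx1 Lx2] [Lw1 Lw2].
case=> [A|[A|[A|A]]].
- apply: (row_barrier (lx := (D w).1) (rx := (D r).1) gD); first lia.
    by move=> t st; split; [apply: A => //; apply: Px|apply: Xr].
  move=> z z2 z1 z1'; exists p, i'; split; first by rewrite sx.
  rewrite /onseg -/w; lia.
- have := A _ _ Pw Pr; lia.
- have := A _ _ Pw Pr; lia.
- by move=> t st; rewrite -Lw1; apply: A => //; apply: Px.
Qed.

Lemma ord3_others (i : 'I_3) : exists i1 i2, [/\ i1 <> i, i2 <> i & i1 <> i2].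
Proof.
case: i => [[|[|[|i]]] hi] //.
- by exists (@Ordinal 3 1 isT), (@Ordinal 3 2 isT).
- by exists (@Ordinal 3 0 isT), (@Ordinal 3 2 isT).
- by exists (@Ordinal 3 0 isT), (@Ordinal 3 1 isT).
Qed.

(* All four directions at p are taken.  If the left one leads to a child, left_wall applies; if it
   leads to the parent q of p, then q has a further child to its left or below it, and the edges
     from
   q to p and to that child form the wall. *)
Lemma left_below H D q jp i j : good H D -> ((size q).+3 < H)%N ->
  let p := rcons q jp in let r := rcons p i in let x := rcons r j in
  dn (D p) (D r) -> lf (D r) (D x) ->
  (forall t, (size (x ++ t) < H)%N -> (D (x ++ t)).1 < (D r).1) ->
  forall t, (size (x ++ t) < H)%N -> (D (x ++ t)).2 < (D p).2.
Proof.
move=> gD sq p r x Dr Lx Xr.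
have sx : size x = (size q).+3 by rewrite !size_rcons.
have sp : size p = (size q).+1 by rewrite !size_rcons.
have sp1 : ((size p).+1 < H)%N by lia.
have sr : (size r < H)%N by rewrite !size_rcons; lia.
have [i1 [i2 [n1 n2 n12]]] := ord3_others i.
have d1 := good_dir i1 gD sp1; have d2 := good_dir i2 gD sp1.
have s1 := good_sibling_dir gD sp1 n1; have s2 := good_sibling_dir gD sp1 n2.
have s12 := good_sibling_dir gD sp1 n12.
have [t1 t2 t3] : [/\ ~ samedir (D p) (D q) (D (rcons p i)),
  ~ samedir (D p) (D q) (D (rcons p i1)) & ~ samedir (D p) (D q) (D (rcons p i2))].
  by split; apply: good_parent_dir gD _; lia.
have dq : lf (D p) (D q) \/ rt (D p) (D q) \/ up (D p) (D q) \/ dn (D p) (D q).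
  have := @good_dir H D q jp gD ltac:(lia).
  rewrite -/p /lf /rt /up /dn; lia.
rewrite /samedir -/r in d1 d2 s1 s2 s12 t1 t2 t3.
(* The other three edges at [p] have distinct directions, none of them downwards. *)
have : lf (D p) (D (rcons p i1)) \/ lf (D p) (D (rcons p i2)) \/ lf (D p) (D q).
  by clear - Dr d1 d2 s1 s2 s12 t1 t2 t3 dq; tauto.
case=> [L|[L|Lq]].
- by apply: (left_wall (i' := i1) gD _ Dr Lx L) => //; lia.
- by apply: (left_wall (i' := i2) gD _ Dr Lx L) => //; lia.
clear d1 d2 s1 s2 s12 t1 t2 t3 dq.
have sq1 : ((size q).+1 < H)%N by lia.
(* The child [p] lies to the right of [q], and at most one of the other two children lies above
   [q]. *)
have [j' [nj Wd]] : exists j', j' <> jp /\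
    (lf (D q) (D (rcons q j')) \/ dn (D q) (D (rcons q j'))).
  have [j1 [j2 [m1 m2 m12]]] := ord3_others jp.
  have d1 := good_dir j1 gD sq1; have d2 := good_dir j2 gD sq1.
  have s1 := good_sibling_dir gD sq1 m1; have s2 := good_sibling_dir gD sq1 m2.
  have s12 := good_sibling_dir gD sq1 m12.
  have Rp : rt (D q) (D p) by move: Lq; rewrite /lf /rt; lia.
  rewrite /samedir -/p in s1 s2 s12.
  have : (lf (D q) (D (rcons q j1)) \/ dn (D q) (D (rcons q j1))) \/
    (lf (D q) (D (rcons q j2)) \/ dn (D q) (D (rcons q j2))).
    by clear - d1 d2 s1 s2 s12 Rp; tauto.
  by case; [exists j1|exists j2].
set w := rcons q j' in Wd.
have sw : (size w < H)%N by rewrite !size_rcons; lia.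
have := @good_apart_branch H D q j' [::] jp [:: i] gD nj.
rewrite -[jp :: [:: i]]/([:: jp] ++ [:: i]) catA !cats1 -/p -/r -/w => /(_ sw sr).
have Pw := pts_root D sw; have Pr := pts_root D sr.
have Px t : (size (x ++ t) < H)%N -> pts (H - size r) (subdrawing D r) (D (x ++ t)).
  by rewrite /x cat_rcons; apply: pts_sub.
have B1 (z : int * int) : z.2 = (D p).2 -> (D q).1 <= z.1 -> z.1 < (D r).1 -> onseg z (D q) (D p).
  move=> z2 z1 z1'; move: Lq Dr; rewrite /onseg /lf /dn; lia.
have xp : (D x).2 < (D p).2 by move: Lx Dr; rewrite /lf /dn; lia.
case: Wd => [[Lw1 Lw2]|[Dw1 Dw2]].
  case=> [A|[A|[A|A]]].
  - apply: (row_barrier (lx := (D w).1) (rx := (D r).1) gD) => //.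
      by move=> t st; split; [apply: A => //; apply: Px|apply: Xr].
    move=> z z2 z1 z1'.
    case: (leP (D q).1 z.1) => zq.
      by exists q, jp; split; [lia|apply: B1].
    exists q, j'; split; first by lia.
    move: Lq; rewrite /onseg -/w /lf; lia.
  - have := A _ _ Pw Pr; move: Dr Lq; rewrite /dn /lf; lia.
  - have := A _ _ Pw Pr; move: Dr Lq; rewrite /dn /lf; lia.
  - move=> t st; have -> : (D p).2 = (D w).2 by case: Lq; lia.
    by apply: A => //; apply: Px.
case=> [A|[A|[A|A]]].
- apply: (row_barrier (lx := (D w).1) (rx := (D r).1) gD) => //.
    by move=> t st; split; [apply: A => //; apply: Px|apply: Xr].
  move=> z z2 z1 z1'; exists q, jp; split; [lia|apply: B1 => //; lia].
- have := A _ _ Pw Pr; move: Dr Lq; rewrite /dn /lf; lia.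
(* The subtree of [r] lies above [w], so the edges from [q] to [w] and to [p] form an L-shaped wall.
   Both inequalities are needed in one induction, since each arm is only crossed within the range
   given by the other. *)
- have Q : forall t, (size (x ++ t) < H)%N ->
    (D q).1 < (D (x ++ t)).1 /\ (D (x ++ t)).2 < (D p).2.
    apply: (subtree_stay (P := fun z => (D q).1 < z.1 /\ z.2 < (D p).2)).
      split=> //; rewrite ltNge; apply/negP => le.
      apply: (@good_nocross H D r j q j' ((D q).1, (D r).2) gD).
      + by move: sx; rewrite /x size_rcons; lia.
      + by rewrite !size_rcons.
      + move: Lx Dr Lq; rewrite /onseg /lf /dn -/x /=; lia.
      + have := A _ _ Pw Pr.
        move: Lx Dr Lq; rewrite /onseg /lf /dn -/w /=; lia.
    move=> t k st [P1 P2]; have al := good_aligned gD k st.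
    have stx : ((size q).+1 < size (x ++ t))%N by rewrite size_cat; lia.
    have P3 := Xr t (ltnW st).
    have P4 := A _ _ Pw (Px t (ltnW st)).
    split; rewrite ltNge; apply/negP => le.
      apply: (@good_nocross H D _ k q j' ((D q).1, (D (x ++ t)).2) gD st stx).
      + move: al; rewrite /aligned /onseg /=; lia.
      + move: Lq; rewrite /onseg /lf -/w /=; lia.
    apply: (@good_nocross H D _ k q jp ((D (x ++ t)).1, (D p).2) gD st stx).
    + move: al; rewrite /aligned /onseg /=; lia.
    + by apply: B1 => //=; apply: ltW.
  by move=> t st; case: (Q t st).
- move=> t st; apply: lt_trans (_ : (D w).2 < _); first by apply: A => //; apply: Px.
  by case: Lq; lia.
Qed.

(** Root and child share a row, so only a vertical line can separate them. *)
Lemma apart_lf m E i : (0 < m)%N ->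
  apart (pts 1 E) (pts m (subdrawing E [:: i])) -> lf (E [::]) (E [:: i]) ->
  forall t, (size t < m)%N -> (E (i :: t)).1 < (E [::]).1.
Proof.
move=> m0 A [L1 L2] t st.
have P1 : pts 1 E (E [::]) by exists [::].
have P2 : pts m (subdrawing E [:: i]) (E [:: i]) by exists [::].
have P3 : pts m (subdrawing E [:: i]) (E (i :: t)) by exists t.
case: A => [|[|[|]]] A; have := A _ _ P1 P2; have := A _ _ P1 P3; lia.
Qed.

Lemma apart_dn m E i : (0 < m)%N ->
  apart (pts 1 E) (pts m (subdrawing E [:: i])) -> dn (E [::]) (E [:: i]) ->
  forall t, (size t < m)%N -> (E (i :: t)).2 < (E [::]).2.
Proof.
move=> m0 /(iso_apart 1 m E (subdrawing E [:: i]) iso_swap) A D.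
by apply: (apart_lf m0 A); move: D; rewrite /dn /lf /=.
Qed.

Lemma subdrawing0 D v : subdrawing D v [::] = D v.
Proof. by rewrite /subdrawing cats0. Qed.

Lemma subdrawing1 D v i : subdrawing D v [:: i] = D (rcons v i).
Proof. by rewrite /subdrawing cats1. Qed.

Lemma subdrawing_cat D v w : subdrawing (subdrawing D v) w = subdrawing D (v ++ w).
Proof. by apply/funext => z; rewrite /subdrawing catA. Qed.

Lemma dihedral_dn p q : aligned p q -> p <> q ->
  exists2 g, dihedral g & dn (g p) (g q).
Proof.
move=> a ne; case: (aligned_dir a ne) => [L|[R|[U|B]]].
- by exists swap; [exact: iso_swap|move: L; rewrite /lf /dn /=].
- exists (swap \o mirror); first exact: iso_swap_mirror.
  move: R; rewrite /rt /dn /=; lia.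
- exists (swap \o (mirror \o swap)); first exact: (DihSwap (DihMirror iso_swap)).
  move: U; rewrite /up /dn /=; lia.
- by exists id; [exact: DihId|].
Qed.

(** A child of [r] on its left or right is confined by [left_below] or its mirror image, a child
    below [r] by the tameness of [r], and none lies above [r], where the edge to [p] is. *)
Lemma child_below H D q jp i : good H D ->
  let p := rcons q jp in let r := rcons p i in
  (size r < H)%N -> dn (D p) (D r) ->
  ((size r).+1 < H -> tame (H - size r).-1 (subdrawing D r))%N ->
  forall t, (size (r ++ t) < H)%N -> (D (r ++ t)).2 < (D p).2.
Proof.
move=> gD p r sr Dr tr t st.
have sr2 : size r = (size q).+2 by rewrite !size_rcons.
case: t st => [|j t] st; first by rewrite cats0; case: Dr.
have {}sr : ((size r).+1 < H)%N by move: st; rewrite size_cat /=; lia.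
have [_ T2 _ _ _] := tr sr.
have m0 : (0 < (H - size r).-1)%N by lia.
have st' : (size t < (H - size r).-1)%N by move: st; rewrite size_cat /=; lia.
have E0 := subdrawing0 D r; have E1 := subdrawing1 D r j.
have Ex s : D (rcons r j ++ s) = subdrawing D r (j :: s) by rewrite cat_rcons.
have Sx s : (size (rcons r j ++ s) < H)%N -> (size s < (H - size r).-1)%N.
  by rewrite size_cat size_rcons; lia.
rewrite -cat_rcons in st *.
case: (good_dir j gD sr) => [L|[R|[U|B]]].
- apply: (left_below gD _ Dr L) => //; first lia.
  move=> s /Sx ss; rewrite Ex -E0; apply: (apart_lf m0 (T2 j)) => //.
  by rewrite E0 E1.
- apply: (left_below (jp := jp) (i := i) (j := j) (good_mirror gD)); rewrite -/p -/r.
  + lia.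
  + by move: Dr; rewrite /dn /=; lia.
  + by move: R; rewrite /lf /rt /=; lia.
  + move=> s /Sx ss; rewrite /comp Ex -E0.
    apply: (apart_lf (E := mirror \o subdrawing D r) m0 _ _ ss).
      by apply/(iso_apart _ _ _ (subdrawing (subdrawing D r) [:: j]) iso_mirror).
    by rewrite /comp E0 E1; move: R; rewrite /lf /rt /=; lia.
  + by [].
- case: (good_parent_dir (q := p) (i := i) (j := j) gD); first by rewrite size_rcons; lia.
  by move: Dr U; rewrite -/r /dn /samedir /up; lia.
- rewrite Ex; case: Dr => _; apply: lt_trans; rewrite -E0.
  by apply: (apart_dn m0 (T2 j)) => //; rewrite E0 E1.
Qed.

(** Induction on the height of the subtree, since [child_below] needs tameness one level down. The
    drawing varies because a symmetry first brings the child below [p]; [p] is not the root because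
    the wall may use the parent of [p]. *)
Lemma good_tame H D p : good H D -> (0 < size p)%N -> ((size p).+1 < H)%N ->
  tame (H - size p).-1 (subdrawing D p).
Proof.
have [k] := ubnP (H - size p); elim: k => // k IH in D p *.
move=> lek gD p0 sp.
case: (lastP p) p0 sp lek => // {p} q jp; set p := rcons q jp => _ sp lek.
have E0 := subdrawing0 D p; have E1 := subdrawing1 D p.
have E2 i j : subdrawing D p [:: i; j] = D (rcons (rcons p i) j).
  by rewrite /subdrawing -cat_rcons cats1.
split=> [i|i|i j ij|i j ij|m1 i j].
- by rewrite E0 E1; apply: good_aligned gD _ _ sp.
- set r := rcons p i.
  have sr : size r = (size p).+1 by rewrite size_rcons.
  have ne : D p <> D r by apply: (good_neq gD); lia.
  have [g ig Dg] := dihedral_dn (good_aligned gD i sp) ne.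
  apply/(iso_apart _ _ _ _ ig); right; right; right; move=> _ _ [w sw ->] [t st ->].
  case: w sw => // _; rewrite /comp E0 subdrawing_cat cats1 -/r.
  apply: (child_below (iso_good ig gD)) => //; rewrite -/p -/r ?sr.
  + lia.
  + move=> s; rewrite -sr; apply: IH; rewrite ?sr //; first lia.
    exact: iso_good.
  + by rewrite size_cat; lia.
- have := @good_apart_branch H D p i [::] j [::] gD ij.
  rewrite !size_cat /= addn1 !subdrawing_cat.
  by rewrite !subnS => K; exact: (K sp sp).
- by rewrite E0 !E1; exact: good_sibling_dir gD sp ij.
- by rewrite E0 E1 E2; apply: good_parent_dir gD _; lia.
Qed.

Lemma good_nice H D p : good H D -> (0 < size p)%N ->
  nice (H - size p) (subdrawing D p).
Proof.
move=> gD p0 w sw; rewrite subdrawing_cat -subnDA -size_cat.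
by apply: good_tame => //; rewrite size_cat; lia.
Qed.

(** * Lower bound for the area of an arbitrary drawing *)

Lemma noup_dihedral (E : drawing) : (forall i j, i <> j -> ~ samedir (E [::]) (E [:: i]) (E [::
  j])) ->
  (forall i, lf (E [::]) (E [:: i]) \/ rt (E [::]) (E [:: i]) \/
     up (E [::]) (E [:: i]) \/ dn (E [::]) (E [:: i])) ->
  exists2 g, dihedral g & forall i, ~ up (g (E [::])) (g (E [:: i])).
Proof.
move=> S D; rewrite /samedir in S.
have [[i Hi]|U] := pselect (exists i, up (E [::]) (E [:: i])); last first.
  by exists id; [exact: DihId|move=> i H; apply: U; exists i].
have [[j Hj]|L] := pselect (exists i, lf (E [::]) (E [:: i])); last first.
  exists (swap \o mirror); first exact: iso_swap_mirror.
  move=> j H; apply: L; exists j; move: H; rewrite /lf /up /=; lia.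
have [[k Hk]|R] := pselect (exists i, rt (E [::]) (E [:: i])); last first.
  exists swap; first exact: iso_swap.
  by move=> k H; apply: R; exists k; move: H; rewrite /rt /up /=.
exists (swap \o (mirror \o swap)); first exact: (DihSwap (DihMirror iso_swap)).
move=> l H.
have {H} Hl : dn (E [::]) (E [:: l]) by move: H; rewrite /dn /up /=; lia.
(* Four used directions would require four distinct children. *)
have : uniq [:: i; j; k; l].
  by rewrite /= !inE !negb_or -!andbA; apply/and5P; split; last apply/andP; try split;
    rewrite // ?andbT; apply/eqP => e; move: Hi Hj Hk Hl; rewrite ?e /up /lf /rt /dn; lia.
by move/card_uniqP => c; have := max_card (mem [:: i; j; k; l]); rewrite c card_ord.
Qed.

Lemma tbox_dihedral g n E l r d u : dihedral g -> tbox n E l r d u ->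
  exists l' r' d' u', tbox n (g \o E) l' r' d' u' /\
    (r' - l' + 1) * (u' - d' + 1) = (r - l + 1) * (u - d + 1).
Proof.
move=> ig tE; elim: ig => [|{}g _ IH|{}g _ IH].
- by exists l, r, d, u.
- have [l' [r' [d' [u' [t e]]]]] := IH.
  exists d', u', l', r'; split; first exact: tbox_swap t.
  by rewrite mulrC.
- have [l' [r' [d' [u' [t e]]]]] := IH.
  exists (- r'), (- l'), d', u'; split; first exact: tbox_mirror t.
  by rewrite -e opprK (addrC (- l')).
Qed.

(** For [w1 = w + k] with [0 < k], the products are at most [(w + k) * (h - t)] and
    [(w - k) * (h + t)], whose sum is [2 * w * h - 2 * k * t]; they cannot both exceed [w * h]. *)
Lemma area_trade (w w1 w2 h p q t : int) : 0 <= p -> 0 <= w1 -> 0 <= w2 -> 0 <= h ->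
  0 <= w -> 0 <= t ->
  w1 + w2 <= w + w -> p <= h - t -> q <= h + t -> w1 * p <= w * h \/ w2 * q <= w * h.
Proof.
move=> p0 w10 w20 h0 w0 t0 ww ph qh.
case: (leP w1 w) => [le|gt]; first by left; apply: ler_pM => //; lia.
set k := w1 - w.
have -> : w1 = w + k by rewrite /k; lia.
have k0 : 0 <= k by lia.
have [H|H] := leP (k * h) (t * (w + k)).
  left; apply: le_trans (_ : (w + k) * (h - t) <= _); first by nia.
  nia.
right; apply: le_trans (_ : w2 * (h + t) <= _); first by nia.
apply: le_trans (_ : (w - k) * (h + t) <= _); first by nia.
nia.
Qed.

Lemma area_le (s h : nat) (w v : int) : (2 * s + 1)%:Z <= w -> h%:Z <= v ->
  ((2 * s + 1) * h)%:Z <= w * v.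
Proof. by move=> H1 H2; rewrite PoszM; apply: ler_pM. Qed.

(* Here the root of D lies in the bounding box of the drawing B of its child i, below it.  Since the
   part of B to the right of its root b reaches the level of the root of D, the left part stays
     below
   it: hence the drawing (s2, h2) obtained from B by lower_left is flatter than B, which compensates
   for (s1, h1) being one unit too tall. *)
Lemma nested_root n (D : drawing) l r d u i j t : good n.+1 D -> (1 < n)%N ->
  tbox n.+1 D l r d u -> dn (D [::]) (D [:: i]) -> rt (D [:: i]) (D [:: i; j]) ->
  (size [:: i, j & t] < n.+1)%N -> (D [::]).2 <= (D [:: i, j & t]).2 ->
  exists s h, ach n.+1 s h /\ ((2 * s + 1) * h)%:Z <= (r - l + 1) * (u - d + 1).
Proof.
move=> gD n1 tD Di Rj st ge.
have n0 : (0 < n)%N by lia.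
have niB : nice n (subdrawing D [:: i]).
  by have := good_nice gD (p := [:: i]) isT; rewrite subn1.
have PD a b : ~ samedir (D [:: a]) (D [::]) (D [:: a; b]).
  by have := @good_parent_dir n.+1 D [::] a b gD ltac:(by []).
have S0 a b : a <> b -> ~ samedir (D [::]) (D [:: a]) (D [:: b]).
  by have := @good_sibling_dir n.+1 D [::] a b gD ltac:(by []).
have nuB : noup n (subdrawing D [:: i]).
  move=> _ k U; apply: (PD i k).
  by move: Di U; rewrite /samedir /dn /up /subdrawing /=; lia.
have tm : tame n.-1 (subdrawing D [:: i]) by apply: nice_tame; rewrite ?prednK //; lia.
have m0 : (0 < n.-1)%N by lia.
have [_ [b [_ [_ Lb _ _]]]] := tame_kids m0 tm (nuB n1).
rewrite /subdrawing /= in Lb.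
case: (tm) => _ T2 _ _ _.
(* The edge to a child on the right would, by the mirror image of [left_wall], keep the node
   [[:: i, j & t]] below the root. *)
have noR k : ~ rt (D [::]) (D [:: k]).
  move=> R.
  have := @left_wall n.+1 (mirror \o D) [::] i j k (good_mirror gD) ltac:(by []).
  have W1 : dn ((mirror \o D) [::]) ((mirror \o D) [:: i]).
    by move: Di; rewrite /dn /=; lia.
  have W2 : lf ((mirror \o D) [:: i]) ((mirror \o D) [:: i; j]).
    by move: Rj; rewrite /rt /lf /=; lia.
  have W3 : lf ((mirror \o D) [::]) ((mirror \o D) [:: k]).
    by move: R; rewrite /rt /lf /=; lia.
  move=> /= /(_ W1 W2 W3) /(_ _ t st) W.
  suff : (D [:: i, j & t]).2 < (D [::]).2 by lia.
  apply: W => s ss; have {}ss : (size s < n.-1)%N by move: ss => /=; lia.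
  apply: (apart_lf (E := mirror \o subdrawing D [:: i]) m0 _ W2 ss).
  by apply/(iso_apart _ _ _ (subdrawing (subdrawing D [:: i]) [:: j]) iso_mirror).
have D0 k := @good_dir n.+1 D [::] k gD ltac:(by []).
rewrite /= in D0.
have [a La] : exists a, lf (D [::]) (D [:: a]).
  apply: (@ord3_cover _ (fun i => dn (D [::]) (D [:: i])) (fun i => up (D [::]) (D [:: i]))).
  - by move=> k; have := D0 k; have := noR k; tauto.
  - by move=> k k' kk; have := S0 _ _ kk; rewrite /samedir; tauto.
  - by move=> k k' kk; have := S0 _ _ kk; rewrite /samedir; tauto.
have [c Uc] : exists a, up (D [::]) (D [:: a]).
  apply: (@ord3_cover _ (fun i => dn (D [::]) (D [:: i])) (fun i => lf (D [::]) (D [:: i]))).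
  - by move=> k; have := D0 k; have := noR k; tauto.
  - by move=> k k' kk; have := S0 _ _ kk; rewrite /samedir; tauto.
  - by move=> k k' kk; have := S0 _ _ kk; rewrite /samedir; tauto.
have Xk : forall t, (size t < n.-1)%N -> (D [:: i, b & t]).2 < (D [::]).2.
  move=> s ss.
  apply: (@left_wall n.+1 D [::] i b a gD _ Di Lb La _ s) => //=; last by lia.
  by move=> s' ss'; apply: (apart_lf m0 (T2 b) Lb); lia.
have [la [ra [da [ua ta]]]] := tbox_ex (subdrawing D [:: a]) n0.
have [lb [rb [db [ub tb]]]] := tbox_ex (subdrawing D [:: i]) n0.
have [lc [rc [dc [uc tc]]]] := tbox_ex (subdrawing D [:: c]) n0.
have [lx [rx [dx [ux tx]]]] := tbox_ex (subdrawing (subdrawing D [:: i]) [:: b]) m0.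
have uxk : ux < (D [::]).2 by case: tx => _ _ [_ [w sw <-]]; apply: Xk.
(* Two candidates to replace the subtree of [i]: [(s1, h1)] fits into its box, while [(s2, h2)] may
   be too wide on the right but is no higher than the distance from [db] to the top [ux] of the left
   part. *)
have [s1 [h1 [a1 B1 B2 B3]]] := lowerP n0 niB nuB tb.
have [s2 [h2 [a2 C1 C2]]] : exists s h, [/\ ach n s h,
    s%:Z <= (subdrawing D [:: i] [::]).1 - lb & h%:Z <= ux - db + 1].
  have := @lower_left n.-1 (subdrawing D [:: i]) lb rb db ub b lx rx dx ux m0.
  by rewrite prednK //; apply.
have nik k : nice n (subdrawing D [:: k]).
  by have := good_nice gD (p := [:: k]) isT; rewrite subn1.
have [sA [hA [aA A1 A2 A3]]] := lowerP n0 (iso_nice iso_swap (nik a))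
  (@noup_child _ n D a iso_swap (fun _ => PD a)
     ltac:(move: La; rewrite /up /lf /=; lia)) (tbox_swap ta).
have iflip : dihedral (swap \o (mirror \o swap)) by exact: (DihSwap (DihMirror iso_swap)).
have [sC [hC [aC F1 F2 F3]]] := lowerP n0 (iso_nice iflip (nik c))
  (@noup_child _ n D c iflip (fun _ => PD c)
     ltac:(move: Uc; rewrite /up /=; lia)) (tbox_swap (tbox_mirror (tbox_swap tc))).
have AP k k' : k <> k' -> apart (pts n (subdrawing D [:: k])) (pts n (subdrawing D [:: k'])).
  move=> kk; have := @good_apart_branch n.+1 D [::] k [::] k' [::] gD kk.
  by rewrite /= subn1 => K; exact: (K n0 n0).
have ai : a <> i by move=> e; move: La Di; rewrite e /lf /dn; lia.
have ci : c <> i by move=> e; move: Uc Di; rewrite e /up /dn; lia.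
have ac : a <> c by move=> e; move: La Uc; rewrite e /lf /up; lia.
have Sab := apart_tbox (AP _ _ ai) ta tb.
have Scb := apart_tbox (AP _ _ ci) tc tb.
have Sac := apart_tbox (AP _ _ ac) ta tc.
have [Ua1 Ua2 Ua3 Ua4] := tbox_child tD ta.
have [Ub1 Ub2 Ub3 Ub4] := tbox_child tD tb.
have [Uc1 Uc2 Uc3 Uc4] := tbox_child tD tc.
have [Ra1 Ra2 Ra3 Ra4] := tbox_root n0 ta.
have [Rb1 Rb2 Rb3 Rb4] := tbox_root n0 tb.
have [Rc1 Rc2 Rc3 Rc4] := tbox_root n0 tc.
have [R1 R2 R3 R4] := tbox_root (ltn0Sn n) tD.
have ubk : (D [::]).2 <= ub.
  apply: le_trans ge _; case: tb => /(_ (j :: t)) K _ _.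
  by have [] : _ := K _; [move: st => /=; lia|move=> _ []].
move: La Di Uc B1 B2 B3 C1 C2 A1 A2 A3 F1 F2 F3.
move: Ra1 Ra2 Ra3 Ra4 Rb1 Rb2 Rb3 Rb4 Rc1 Rc2 Rc3 Rc4.
rewrite /lf /dn /up /subdrawing /=.
move: R1 R2 R3 R4 uxk ubk.
set x := (D [::]).1; set y := (D [::]).2.
move: (D [:: a]).1 (D [:: a]).2 (D [:: i]).1 (D [:: i]).2 (D [:: c]).1 (D [:: c]).2 x y.
move=> xa ya xi yi xc yc x y *.
clear ta tb tc tx tD Xk gD niB nik nuB PD S0 tm T2 noR D0 AP Lb Rj st ge ai ci ac.
have {Sab} Sab : ra < lb by lia.
have {Scb} Scb : ub < dc by lia.
have {Sac} Sac : ra < lc \/ ua < dc by lia.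
(* The free direction at the root is the right one, so the new drawing is compared after a quarter
   turn: [a] plays the part of the child below, and [i] or [c] that of the side children. *)
have big s h : ach n.+1 s h -> (2 * s + 1)%:Z <= u - d + 1 -> h%:Z <= r - l + 1 ->
  exists s h, ach n.+1 s h /\ ((2 * s + 1) * h)%:Z <= (r - l + 1) * (u - d + 1).
  by move=> ash ls lh; exists s, h; split=> //; rewrite mulrC; apply: area_le.
have [s2U|s2U] := leP s2%:Z (r - x).
  (* If [h2] does not fit above the root, then [hC <= u - y < h2 <= y - d], and [c] is doubled
     instead. *)
  have [h2R|h2R] := leP h2%:Z (u - y).
    by apply: (big _ _ (AchWide aA a2)); lia.
  case: Sac => Sac.
    by apply: (big _ _ (AchWide aA aC)); lia.
  by apply: (big _ _ (AchNarrow aA aC)); lia.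
(* As [sC <= r - x < s2], Construction 2 with [c] fits unless [hC] exceeds the room below the
   root. *)
have [hCL|hCL] := leP hC%:Z (y - d).
  by apply: (big _ _ (AchWide aA aC)); lia.
have : (2 * maxn h1 sA + 1)%:Z * (1 + 2 * s1 + hA)%:Z <= (u - d + 1) * (r - l + 1) \/
       (2 * maxn h2 sA + 1)%:Z * (1 + 2 * s2 + hA)%:Z <= (u - d + 1) * (r - l + 1).
  (* Here [s1 <= r - x < s2]. The first height is at least [s2 - s1] below [r - l + 1], the second
     at most [s2 - s1] above it, and [y - d < hC] makes the widths average at most [u - d + 1]. *)
  by apply: (@area_trade _ _ _ _ _ _ (s2%:Z - s1%:Z)); lia.
case=> K.
  by exists (maxn h1 sA), (1 + 2 * s1 + hA)%N; split; [exact: AchWide|rewrite PoszM; lia].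
by exists (maxn h2 sA), (1 + 2 * s2 + hA)%N; split; [exact: AchWide|rewrite PoszM; lia].
Qed.

Lemma lower_area n D l r d u : (0 < n)%N -> good n D -> tbox n D l r d u ->
  exists s h, ach n s h /\ ((2 * s + 1) * h)%:Z <= (r - l + 1) * (u - d + 1).
Proof.
case: n => // n _ gD tD.
have [R1 R2 R3 R4] := tbox_root (ltn0Sn n) tD.
case: (posnP n) gD tD => [-> _ _|n0 gD tD].
  by exists 0%N, 1%N; split; [exact: Ach1|apply: area_le; lia].
have s1 : ((size ([::] : seq 'I_3)).+1 < n.+1)%N by [].
have [ap|nap] := pselect (forall i, apart (pts 1 D) (pts n (subdrawing D [:: i]))).
  have S0 i j : i <> j -> ~ samedir (D [::]) (D [:: i]) (D [:: j]).
    exact: good_sibling_dir gD s1.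
  have tD0 : tame n D.
    split=> //.
    - by move=> i; apply: (good_aligned gD i s1).
    - move=> i j ij; have := @good_apart_branch n.+1 D [::] i [::] j [::] gD ij.
      by rewrite /= subn1 => K; exact: (K n0 n0).
    - by move=> n1 i j; apply: (@good_parent_dir n.+1 D [::] i j gD).
  have nD : nice n.+1 D.
    by case=> [_ //|i w] sw; apply: good_tame.
  have [g ig nu] := noup_dihedral S0 (fun i => good_dir i gD s1).
  have [l' [r' [d' [u' [t' <-]]]]] := tbox_dihedral ig tD.
  have [s [h [a H1 H2 H3]]] := lowerP (ltn0Sn n) (iso_nice ig nD) (fun _ => nu) t'.
  by exists s, h; split=> //; apply: area_le; lia.
have {nap} [i nap] : exists i, ~ apart (pts 1 D) (pts n (subdrawing D [:: i])).
  by apply: contrapT => H; apply: nap => i; apply: contrapT => H'; apply: H; exists i.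
have ne : D [::] <> D [:: i] by apply: (good_neq gD).
have [g ig Dg] := dihedral_dn (good_aligned gD i s1) ne.
have [l' [r' [d' [u' [{}tD <-]]]]] := tbox_dihedral ig tD.
have {}gD := iso_good ig gD.
have {}nap : ~ apart (pts 1 (g \o D)) (pts n (subdrawing (g \o D) [:: i])).
  by move/(iso_apart 1 n D (subdrawing D [:: i]) ig).
have {}Dg : dn ((g \o D) [::]) ((g \o D) [:: i]) by [].
move: (g \o D) gD nap Dg tD => {R1 R2 R3 R4 ne ig g}D gD nap Dg tD.
have [t st ge] : exists2 t, (size (i :: t) < n.+1)%N & (D [::]).2 <= (D (i :: t)).2.
  apply: contrapT => H; apply: nap; right; right; right.
  move=> _ _ [w sw ->] [t st ->]; case: w sw => // _.
  by rewrite ltNge; apply/negP => ge; apply: H; exists t.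
case: t st ge => [|j t] st ge; first by case: Dg; lia.
have n1 : (1 < n)%N by move: st => /=; lia.
have m0 : (0 < n.-1)%N by lia.
have := good_tame (p := [:: i]) gD isT n1; rewrite /= subn1 => -[_ T2 _ _ _].
(* A descendant of [i] level with the root must come from a side child of [i]: the edge to the root
   leads upwards, and the subtree of a child below [i] stays below. *)
have U : ~ up (D [:: i]) (D [:: i; j]).
  move=> U; apply: (@good_parent_dir n.+1 D [::] i j gD) => //=.
  by move: Dg U; rewrite /samedir /dn /up; lia.
have B : ~ dn (D [:: i]) (D [:: i; j]).
  move=> B; have := @apart_dn n.-1 (subdrawing D [:: i]) j m0 (T2 j) B t.
  rewrite /subdrawing /=; case: Dg => _ lt /(_ ltac:(move: st => /=; lia)); lia.
have := @good_dir n.+1 D [:: i] j gD n1; rewrite /= => -[L|[R|[]//]].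
  have {}Dg : dn ((mirror \o D) [::]) ((mirror \o D) [:: i]).
    by move: Dg; rewrite /dn /=; lia.
  have {}L : rt ((mirror \o D) [:: i]) ((mirror \o D) [:: i; j]).
    by move: L; rewrite /lf /rt /=; lia.
  have [s [h [a H]]] := nested_root (good_mirror gD) n1 (tbox_mirror tD) Dg L st ge.
  by exists s, h; split=> //; rewrite opprK (addrC (- l')) in H.
exact: nested_root gD n1 tD Dg R st ge.
Qed.

(** * From the real plane to the grid *)

Section RealGeometry.
Variable R : realType.
Local Open Scope classical_set_scope.

Lemma between_affine (a b z : R) :
  (a <= z /\ z <= b) \/ (b <= z /\ z <= a) <->
  exists2 t : R, 0 <= t <= 1 & z = a + t * (b - a).
Proof.
split; last first.
  move=> [t /andP[t0 t1] ->]; case: (leP a b) => ab; [left|right]; split; nra.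
have [->|ne] := eqVneq a b.
  by move=> H; exists 0; [rewrite lexx ler01|lra].
have ba : b - a != 0 by rewrite subr_eq0 eq_sym.
move=> H; exists ((z - a) / (b - a)); last by rewrite mulfVK //; lra.
case: H => -[H1 H2].
- have ab : 0 < b - a by rewrite subr_gt0 lt_neqAle ne (le_trans H1 H2).
  by rewrite divr_ge0 ?ler_pdivrMr //=; lra.
- have ab : 0 < a - b by rewrite subr_gt0 lt_neqAle eq_sym ne (le_trans H1 H2).
  have -> : (z - a) / (b - a) = (a - z) / (a - b).
    by rewrite -(opprB a z) -(opprB a b) invrN mulrNN.
  by rewrite divr_ge0 ?ler_pdivrMr //=; lra.
Qed.

Definition ronseg (z : R * R) (p q : int * int) : Prop :=
  ((p.1%:~R <= z.1 /\ z.1 <= q.1%:~R) \/ (q.1%:~R <= z.1 /\ z.1 <= p.1%:~R)) /\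
  ((p.2%:~R <= z.2 /\ z.2 <= q.2%:~R) \/ (q.2%:~R <= z.2 /\ z.2 <= p.2%:~R)).

Lemma segment_ronseg z p q :
  segment (grid_point R p) (grid_point R q) z -> ronseg z p q.
Proof.
move=> [t t01 ->] /=; split; apply/between_affine; exists t => //.
Qed.

Lemma ronseg_segment z p q : aligned p q -> ronseg z p q ->
  segment (grid_point R p) (grid_point R q) z.
Proof.
case: z => z1 z2 [e|e] [/= H1 H2].
- move/between_affine: H2 => [t t01 ->]; exists t => //=.
  by congr pair; rewrite e in H1 *; lra.
- move/between_affine: H1 => [t t01 ->]; exists t => //=.
  by congr pair; rewrite e in H2 *; lra.
Qed.

Lemma ronseg_grid z p q : ronseg (grid_point R z) p q <-> onseg z p q.
Proof. by rewrite /ronseg /onseg /= !ler_int. Qed.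

Lemma grid_point_inj : injective (grid_point R).
Proof. by move=> [a b] [c d] [/intr_inj -> /intr_inj ->]. Qed.

Lemma drawn_tbox n E l r d u z : tbox n E l r d u -> drawn n E z ->
  (l%:~R <= z.1 /\ z.1 <= r%:~R) /\ (d%:~R <= z.2 /\ z.2 <= u%:~R :> R).
Proof.
move=> [T _ _] [[v nv ->]|[v [i [nv /segment_ronseg]]]].
  by rewrite /= !ler_int; apply: T.
have := T _ nv; have := T v; rewrite -!(ler_int R) /is_node size_rcons in nv *.
move=> /(_ (ltnW nv)) H1 H2 H3; move: H1 H2 H3; rewrite /ronseg; lra.
Qed.

Lemma in_int_interval n E l r d u : tbox n E l r d u -> drawn n E `<=`
  `[l%:~R, r%:~R] `*` `[d%:~R, u%:~R : R].
Proof.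
move=> tE z /(drawn_tbox tE) [[h1 h2] [h3 h4]]; split; rewrite /= in_itv /=.
  by rewrite h1 h2.
by rewrite h3 h4.
Qed.

(** A rectangle around the drawing contains the nodes that attain the four sides, hence the whole
    integer box. *)
Lemma enclosing_tbox n E l r d u : tbox n E l r d u ->
  smallest (@axis_rectangle R) (drawn n E) =
  `[l%:~R, r%:~R] `*` `[d%:~R, u%:~R].
Proof.
move=> tE; apply/seteqP; split.
  by apply: smallest_sub; [exists l%:~R, r%:~R, d%:~R, u%:~R|exact: in_int_interval].
move=> z [/= zx zy] B [[a [b [c [e ->]]]] sub].
have node w : (size w < n)%N -> (`[a, b] `*` `[c, e]) (grid_point R (E w)).
  by move=> sw; apply: sub; left; exists w.
case: tE => _ [[w1 s1 <-] [w2 s2 <-]] [[w3 s3 <-] [w4 s4 <-]] in zx zy.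
have [/= + _] := node _ s1; have [/= + _] := node _ s2.
have [/= _ +] := node _ s3; have [/= _ +] := node _ s4.
move: zx zy; rewrite !in_itv /= => /andP[? ?] /andP[? ?] /andP[? ?] /andP[? ?] /andP[? ?] /andP[?
  ?].
by split; apply/andP; split; lra.
Qed.

Lemma tbox_apart n m E F l r d u l' r' d' u' : tbox n E l r d u ->
  tbox m F l' r' d' u' -> r < l' \/ r' < l \/ u < d' \/ u' < d ->
  apart (pts n E) (pts m F).
Proof.
move=> [T _ _] [T' _ _].
case=> [H|[H|[H|H]]]; [left|right; left|right; right; left|right; right; right];
  move=> _ _ [v sv ->] [w sw ->]; have := T v sv; have := T' w sw; lia.
Qed.

Lemma enclosing_disjoint n m E F l r d u l' r' d' u' : 
  (0 < n)%N -> (0 < m)%N -> tbox n E l r d u -> tbox m F l' r' d' u' ->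
  smallest (@axis_rectangle R) (drawn n E) `&`
    smallest (@axis_rectangle R) (drawn m F) = set0 <->
  (r < l' \/ r' < l \/ u < d' \/ u' < d).
Proof.
move=> n0 m0 tE tF; rewrite (enclosing_tbox tE) (enclosing_tbox tF); split; last first.
  move=> H; apply/seteqP; split=> // z [[/=]]; rewrite !in_itv /=.
  move=> /andP[a1 a2] /andP[a3 a4] [/=] /andP[a5 a6] /andP[a7 a8].
  move: H; rewrite -!(ltr_int R); lra.
move=> e; have [e1 e2 e3 e4] := tbox_root n0 tE; have [f1 f2 f3 f4] := tbox_root m0 tF.
have [H|H] := EM (r < l' \/ r' < l \/ u < d' \/ u' < d) => //; exfalso.
(* This is the lower left corner of the intersection of the boxes. *)
suff : set0 (grid_point R (Order.max l l', Order.max d d')) by [].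
rewrite -e; split; split; rewrite /= ?in_itv /= !ler_int; lia.
Qed.

Lemma good_of_planar n D : planar_orthogonal_grid_drawing R n D ->
  subtree_separation R n D -> good n D.
Proof.
case=> inj ort ncr sep; split.
- by move=> v w sv sw; apply: inj.
- by move=> v i sv; apply: ort; rewrite /is_node size_rcons.
- move=> u i v j su sv ne z /ronseg_grid z1 /ronseg_grid z2.
  have nu : is_node n (rcons u i) by rewrite /is_node size_rcons.
  have nv : is_node n (rcons v j) by rewrite /is_node size_rcons.
  have [w [w1 w2 /grid_point_inj e]] := ncr u i v j nu nv ne _
    (ronseg_segment (ort _ _ nu) z1) (ronseg_segment (ort _ _ nv) z2).
  by exists w.
- move=> u v su sv uv vu.
  have nu : (0 < n - size u)%N by lia.
  have nv : (0 < n - size v)%N by lia.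
  have [l [r [d [t tu]]]] := tbox_ex (subdrawing D u) nu.
  have [l' [r' [d' [t' tv]]]] := tbox_ex (subdrawing D v) nv.
  apply: (tbox_apart tu tv); apply/(enclosing_disjoint nu nv tu tv).
  (* Two prefixes of the same word are comparable. *)
  apply: sep => // -[w [_ /prefixP[a ->]]].
  move=> /prefixP[b e]; case: (leqP (size u) (size v)) => s.
    by case/negP: uv; rewrite prefixE -(takel_cat b s) -e take_size_cat.
  by case/negP: vu; rewrite prefixE -(takel_cat a (ltnW s)) e take_size_cat.
Qed.

Lemma floor_between (a b : int) (z : R) : a%:~R <= z -> z <= b%:~R ->
  a <= Num.floor z /\ Num.floor z <= b.
Proof.
move=> az zb; split; first by rewrite Num.Theory.floor_ge_int.
by rewrite -(ler_int R); apply: le_trans zb; apply: floor_le.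
Qed.

Lemma ceil_between (a b : int) (z : R) : a%:~R <= z -> z <= b%:~R ->
  a <= Num.ceil z /\ Num.ceil z <= b.
Proof.
move=> az zb; split; last by rewrite Num.Theory.ceil_le_int.
by rewrite -(ler_int R); apply: le_trans az _; apply: ceil_ge.
Qed.

(** Rounding is monotone and fixes the integer bounds. *)
Lemma ronseg_floor z p q : ronseg z p q -> onseg (Num.floor z.1, Num.floor z.2) p q.
Proof.
by case=> -[[] H1 H2|[] H1 H2] [[H3 H4]|[H3 H4]]; split=> /=;
  have := floor_between H1 H2; have := floor_between H3 H4; tauto.
Qed.

Lemma ronseg_ceil z p q : ronseg z p q -> onseg (Num.ceil z.1, Num.ceil z.2) p q.
Proof.
by case=> -[[] H1 H2|[] H1 H2] [[H3 H4]|[H3 H4]]; split=> /=;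
  have := ceil_between H1 H2; have := ceil_between H3 H4; tauto.
Qed.

(* A common point of two edges that is not a grid point has its floor and ceiling on both edges,
   which would then share both endpoints. *)
Lemma planar_of_good n D : good n D ->
  planar_orthogonal_grid_drawing R n D /\ subtree_separation R n D.
Proof.
move=> gD; split; first split.
- by move=> v w sv sw; apply: (good_inj gD).
- by move=> v i; rewrite /is_node size_rcons => /(good_aligned gD i).
- move=> u i v j; rewrite /is_node !size_rcons => su sv ne z.
  move=> /segment_ronseg z1 /segment_ronseg z2.
  have [w [w1 w2 ef]] := good_noncross gD su sv ne (ronseg_floor z1) (ronseg_floor z2).
  have [w' [w1' w2' ec]] := good_noncross gD su sv ne (ronseg_ceil z1) (ronseg_ceil z2).
  have [e|/eqP nw] := eqVneq w w'.
    exists w; split=> //; rewrite -ef; case: z {z1 z2} ef ec => x y /= ef ec.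
    have [e1 e2] : Num.floor x = Num.ceil x /\ Num.floor y = Num.ceil y.
      by move: ef; rewrite e -ec => -[].
    have := floor_le x; have := ceil_ge x; have := floor_le y; have := ceil_ge y.
    by rewrite -e1 -e2 /grid_point /= => ? ? ? ?; congr pair; lra.
  (* Two distinct common nodes are the ends of both edges; comparing depths leaves [u = v] and then
     [i = j]. *)
  exfalso; apply: ne.
  have sz (a : seq 'I_3) b : size (rcons a b) = (size a).+1 by rewrite size_rcons.
  move: w1 w2 w1' w2'; rewrite !inE => /orP[]/eqP a1 /orP[]/eqP a2 /orP[]/eqP a3 /orP[]/eqP a4;
    try (by case: nw; rewrite ?a1 ?a3 // ?a2 ?a4);
    try (by have := congr1 (@size 'I_3) a1; have := congr1 (@size 'I_3) a2;
      have := congr1 (@size 'I_3) a3; have := congr1 (@size 'I_3) a4; rewrite !sz; lia).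
  + have e : u = v by rewrite -a1.
    by rewrite a4 e in a3; have [ij] := rcons_inj a3; rewrite e ij.
  + have e : u = v by rewrite -a3.
    by rewrite a2 e in a1; have [ij] := rcons_inj a1; rewrite e ij.
- move=> u v su sv dis.
  have nu : (0 < n - size u)%N by rewrite subn_gt0.
  have nv : (0 < n - size v)%N by rewrite subn_gt0.
  have [l [r [d [t tu]]]] := tbox_ex (subdrawing D u) nu.
  have [l' [r' [d' [t' tv]]]] := tbox_ex (subdrawing D v) nv.
  apply/(enclosing_disjoint nu nv tu tv); apply: apart_tbox tu tv.
  apply: good_apart => //; apply/negP => p; apply: dis.
    by exists v; split=> //; apply: prefix_refl.
  by exists u; split=> //; apply: prefix_refl.
Qed.

(** A discrete intermediate value argument along the path from the root to [v]; it shows that the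
    occupied columns have no gaps. *)
Lemma column_reached n E x v : is_node n v ->
  ((E [::]).1 <= x /\ x <= (E v).1) \/ ((E v).1 <= x /\ x <= (E [::]).1) ->
  grid_columns R n E x.
Proof.
elim/last_ind: v => [|v i IH] nv H.
  have -> : x = (E [::]).1 by lia.
  by exists (E [::]).2%:~R; left; exists [::].
have nv' : is_node n v by move: nv; rewrite /is_node size_rcons; apply: ltnW.
have [K|K] : (((E [::]).1 <= x /\ x <= (E v).1) \/ ((E v).1 <= x /\ x <= (E [::]).1)) \/
    (((E v).1 <= x /\ x <= (E (rcons v i)).1) \/ ((E (rcons v i)).1 <= x /\ x <= (E v).1)).
  lia.
  exact: IH.
rewrite -!(ler_int R) in K.
have [t t01 e] := (between_affine _ _ _).1 K.
exists ((E v).2%:~R + t * ((E (rcons v i)).2%:~R - (E v).2%:~R)); right; exists v, i.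
by split=> //; exists t => //=; rewrite e.
Qed.

Lemma grid_columns_tbox n E l r d u : tbox n E l r d u ->
  grid_columns R n E = [set x | l <= x /\ x <= r].
Proof.
move=> tE; apply/seteqP; split=> x.
  by case=> y /(drawn_tbox tE) [/=]; rewrite !ler_int.
case: tE => _ [[w1 s1 <-] [w2 s2 <-]] _ /= H.
have [K|K] := leP (E [::]).1 x.
  by apply: (column_reached s2); left; case: H.
by apply: (column_reached s1); right; split; [case: H|exact: ltW].
Qed.

Lemma grid_rows_columns n E : grid_rows R n E = grid_columns R n (swap \o E).
Proof.
have H F (a b : R) : drawn n F (a, b) -> drawn n (swap \o F) (b, a).
  move=> [[v nv [-> ->]]|[v [i [nv [t t01 [-> ->]]]]]]; first by left; exists v.
  by right; exists v, i; split=> //; exists t.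
apply/seteqP; split=> y [x Hx]; exists x; first exact: H.
by have := H _ _ _ Hx; have -> : swap \o (swap \o E) = E by apply/funext => v; rewrite /= swapK.
Qed.

Lemma grid_rows_tbox n E l r d u : tbox n E l r d u ->
  grid_rows R n E = [set y | d <= y /\ y <= u].
Proof. by move=> /tbox_swap /grid_columns_tbox; rewrite grid_rows_columns. Qed.

Lemma card_int_interval (l r : int) : l <= r ->
  #|` fset_set [set x | l <= x /\ x <= r]|%:Z = r - l + 1.
Proof.
move=> lr; pose m := absz (r - l + 1).
have -> : [set x | l <= x /\ x <= r] = (fun k : nat => l + k%:Z) @` `I_m.
  apply/seteqP; split=> x /=; first by move=> H; exists (absz (x - l)); lia.
  by case=> k /= H <-; lia.
rewrite (@card_fset_set _ _ m); first by lia.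
by apply: inj_card_eq => a b _ _; lia.
Qed.

Lemma area_tbox n E l r d u : (0 < n)%N -> tbox n E l r d u ->
  (area R n E)%:Z = (r - l + 1) * (u - d + 1).
Proof.
move=> n0 tE; have [? ? ? ?] := tbox_root n0 tE.
rewrite /area PoszM /width /height (grid_columns_tbox tE) (grid_rows_tbox tE).
by rewrite !card_int_interval //; lia.
Qed.

End RealGeometry.

(** * Realising the symmetric drawings *)

Definition translate (t p : int * int) : int * int := (p.1 + t.1, p.2 + t.2).

Lemma tbox_translate n E l r d u t : tbox n E l r d u ->
  tbox n (translate t \o E) (l + t.1) (r + t.1) (d + t.2) (u + t.2).
Proof.
case=> H [[w1 s1 e1] [w2 s2 e2]] [[w3 s3 e3] [w4 s4 e4]]; split.
- by move=> w /H; rewrite /=; lia.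
- by split; [exists w1|exists w2]; rewrite //= (e1, e2).
- by split; [exists w3|exists w4]; rewrite //= (e3, e4).
Qed.

Lemma apart_translate n m E F t : apart (pts n E) (pts m F) ->
  apart (pts n (translate t \o E)) (pts m (translate t \o F)).
Proof.
case=> [H|[H|[H|H]]]; [left|right; left|right; right; left|right; right; right];
  move=> _ _ [w sw ->] [v sv ->];
  have := H _ _ (ex_intro2 _ _ w sw erefl) (ex_intro2 _ _ v sv erefl);
  rewrite /=; lia.
Qed.

Lemma good_translate H D t : good H D -> good H (translate t \o D).
Proof.
case=> G1 G2 G3 G4; split.
- move=> v w sv sw [e1 e2]; apply: G1 => //.
  by move: e1 e2; case: (D v) (D w) => a b [c d] /= e1 e2; congr pair; lia.
- by move=> v i /(G2 _ i); rewrite /aligned /=; lia.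
- move=> u i v j su sv ne z z1 z2.
  have [||w [w1 w2 e]] := G3 _ _ _ _ su sv ne (z.1 - t.1, z.2 - t.2).
  + by move: z1; rewrite /onseg /=; lia.
  + by move: z2; rewrite /onseg /=; lia.
  + exists w; split=> //; rewrite /= /translate -e /=; case: z {z1 z2 e} => a b /=.
    by congr pair; lia.
- by move=> u v su sv uv vu; apply: apart_translate; apply: G4.
Qed.

(** The invariant that allows an edge from a parent above to be attached at the root. *)
Definition ray_free (n : nat) (E : drawing) : Prop := forall v i z,
  ((size v).+1 < n)%N -> onseg z (E v) (E (rcons v i)) ->
  z.1 = (E [::]).1 -> (E [::]).2 <= z.2 -> v = [::] /\ z = E [::].

(** Different children are kept apart by their boxes alone. Only the edge from the root into a child
    needs a finer condition, the last one, which [ray_free] supplies. *)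
Lemma good_join n D (l r d u : 'I_3 -> int) : (0 < n)%N ->
  (forall i, good n (subdrawing D [:: i])) ->
  (forall i, tbox n (subdrawing D [:: i]) (l i) (r i) (d i) (u i)) ->
  (forall i j, i <> j -> r i < l j \/ r j < l i \/ u i < d j \/ u j < d i) ->
  (forall i, aligned (D [::]) (D [:: i])) ->
  (forall i j z, i <> j -> onseg z (D [::]) (D [:: i]) ->
     z.1 < l j \/ r j < z.1 \/ z.2 < d j \/ u j < z.2) ->
  (forall i j z, i <> j -> onseg z (D [::]) (D [:: i]) ->
     onseg z (D [::]) (D [:: j]) -> z = D [::]) ->
  (forall i v j z, ((size v).+1 < n)%N -> onseg z (D [::]) (D [:: i]) ->
     onseg z (D (i :: v)) (D (i :: rcons v j)) -> v = [::] /\ z = D [:: i]) ->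
  good n.+1 D.
Proof.
move=> n0 gS tS aS al eS eR eC.
have bx i v : (size v < n)%N -> (l i <= (D (i :: v)).1 /\ (D (i :: v)).1 <= r i) /\
    (d i <= (D (i :: v)).2 /\ (D (i :: v)).2 <= u i).
  by move=> sv; case: (tS i) => /(_ v sv).
have bxe i v j z : ((size v).+1 < n)%N -> onseg z (D (i :: v)) (D (i :: rcons v j)) ->
    (l i <= z.1 /\ z.1 <= r i) /\ (d i <= z.2 /\ z.2 <= u i).
  move=> sv; have := bx i v (ltnW sv).
  by have := bx i (rcons v j); rewrite size_rcons => /(_ sv); rewrite /onseg; lia.
(* The root is an end of the edge to another child, which avoids the box of [i]. *)
have root i v : (size v < n)%N -> D [::] <> D (i :: v).
  move=> sv e; have [j [_ [ji _ _]]] := ord3_others i.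
  have := eS j i (D [::]) ji (onseg_l _ _).
  by have := bx i v sv; rewrite -e; lia.
split.
- case=> [|i v] [|j w] //= sv sw e.
  + by case: (root j w).
  + by case: (root i v).
  + have [ij|/eqP ij] := eqVneq i j.
      by subst j; rewrite (good_inj (gS i) sv sw e).
    by have := aS _ _ ij; have := bx i v sv; have := bx j w sw; rewrite e; lia.
- by case=> [|k v] i sv /=; [exact: al|exact: (good_aligned (gS k))].
- case=> [|k v] i [|k' w] j /= sv sw ne z.
  + move=> z1 z2; exists [::]; split; rewrite ?inE //.
    by apply: (eR i j z) => // ij; apply: ne; rewrite ij.
  + move=> z1 z2; have [ik|/eqP ik] := eqVneq i k'.
      subst k'; have [-> e] := eC i w j z sw z1 z2.
      by exists [:: i]; split; rewrite ?inE ?eqxx ?orbT.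
    by have := eS _ _ z ik z1; have := bxe _ _ _ _ sw z2; lia.
  + move=> z2 z1; have [ik|/eqP ik] := eqVneq j k.
      subst k; have [-> e] := eC j v i z sv z1 z2.
      by exists [:: j]; split; rewrite ?inE ?eqxx ?orbT.
    by have := eS _ _ z ik z1; have := bxe _ _ _ _ sv z2; lia.
  + have [kk|/eqP kk] := eqVneq k k'.
      subst k' => z1 z2.
      have ne' : (v, i) <> (w, j) by case=> e1 e2; apply: ne; rewrite e1 e2.
      have [x [x1 x2 e]] := good_noncross (gS k) sv sw ne' z1 z2.
      exists (k :: x); split=> //.
        by move: x1; rewrite !inE => /orP[]/eqP ->; rewrite eqxx ?orbT.
      by move: x2; rewrite !inE => /orP[]/eqP ->; rewrite eqxx ?orbT.
    move=> /bxe z1 /bxe z2; have := z1 sv; have := z2 sw; have := aS _ _ kk; lia.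
- case=> [|i v] [|j w] // sv sw vw wv.
  have [ij|/eqP ij] := eqVneq i j.
    subst j; have := good_apart (gS i) sv sw.
    by rewrite /= !eqxx /= in vw wv; move=> /(_ vw wv).
  have A := tbox_apart (tS i) (tS j) (aS i j ij).
  have P k x z : pts (n.+1 - size (k :: x)) (subdrawing D (k :: x)) z ->
      pts n (subdrawing D [:: k]) z.
    by move=> [y sy ->]; exists (x ++ y) => //; rewrite size_cat; move: sy => /=; lia.
  by case: A => [H|[H|[H|H]]]; [left|right; left|right; right; left|right; right; right];
    move=> p q /P Hp /P Hq; apply: H.
Qed.

Lemma tbox_join n D (l r d u : 'I_3 -> int) l' r' d' u' :
  (forall i, tbox n (subdrawing D [:: i]) (l i) (r i) (d i) (u i)) ->
  (l' <= (D [::]).1 /\ (D [::]).1 <= r') /\ (d' <= (D [::]).2 /\ (D [::]).2 <= u') ->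
  (forall i, (l' <= l i /\ r i <= r') /\ (d' <= d i /\ u i <= u')) ->
  (exists i, l' = l i) -> (exists i, r' = r i) ->
  (exists i, d' = d i) -> (exists i, u' = u i) ->
  tbox n.+1 D l' r' d' u'.
Proof.
move=> tS rt kids [i1 e1] [i2 e2] [i3 e3] [i4 e4]; split.
- case=> [|i w] sw; first exact: rt.
  case: (tS i) => /(_ w sw) + _ _; have := kids i.
  rewrite /subdrawing /=; lia.
- rewrite e1 e2; case: (tS i1) => _ [[w1 s1 <-] _] _; case: (tS i2) => _ [_ [w2 s2 <-]] _.
  by split; [exists (i1 :: w1)|exists (i2 :: w2)].
- rewrite e3 e4; case: (tS i3) => _ _ [[w1 s1 <-] _]; case: (tS i4) => _ _ [_ [w2 s2 <-]].
  by split; [exists (i3 :: w1)|exists (i4 :: w2)].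
Qed.

(* The child a hangs q units below its usual place, and b and c are p units further apart:
   Construction 1 is (p, q) = (s_A, 0) and Construction 2 is (p, q) = (0, s_B). *)
Definition join (A B : drawing) (p q uA uB : int) : drawing := fun v =>
  match v with
  | [::] => (0, 0)
  | i :: w => match val i with
    | 0%N => translate (0, - q - 1 - uA) (A w)
    | 1%N => translate (- p - 1 - uB, 0) (swap (mirror (B w)))
    | _ => translate (p + 1 + uB, 0) (mirror (swap (B w)))
    end
  end.

Lemma ord3P (P : 'I_3 -> Prop) : P (@Ordinal 3 0 isT) -> P (@Ordinal 3 1 isT) ->
  P (@Ordinal 3 2 isT) -> forall i, P i.
Proof.
by move=> P0 P1 P2 [[|[|[|i]]] hi] //;
  [move: P0|move: P1|move: P2]; congr P; apply: val_inj.
Qed.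

Definition at3 (T : Type) (x y z : T) (i : 'I_3) : T :=
  match val i with 0%N => x | 1%N => y | _ => z end.

Lemma is_max_interval (a b m : int) : a <= b -> m = b ->
  is_max [set x | a <= x /\ x <= b]%classic m.
Proof. by move=> ab ->; split=> [|x []] /=; lia. Qed.

Lemma is_min_interval (a b m : int) : a <= b -> m = a ->
  is_min [set x | a <= x /\ x <= b]%classic m.
Proof. by move=> ab ->; split=> [|x []] /=; lia. Qed.

Section Join.
Variables (n : nat) (A B : drawing) (sA sB dA uA dB uB p q : int).
Hypotheses (n0 : (0 < n)%N) (gA : good n A) (gB : good n B).
Hypotheses (rA : ray_free n A) (rB : ray_free n B).
Hypotheses (A0 : A [::] = (0, 0)) (B0 : B [::] = (0, 0)).
Hypotheses (tA : tbox n A (- sA) sA dA uA) (tB : tbox n B (- sB) sB dB uB).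
Hypotheses (p0 : 0 <= p) (q0 : 0 <= q) (pq : sA <= p \/ sB <= q).

Let D := join A B p q uA uB.
Let l : 'I_3 -> int := at3 (- sA) (- p - 1 - (uB - dB)) (p + 1).
Let r : 'I_3 -> int := at3 sA (- p - 1) (p + 1 + (uB - dB)).
Let d : 'I_3 -> int := at3 (- q - 1 - (uA - dA)) (- sB) (- sB).
Let u : 'I_3 -> int := at3 (- q - 1) sB sB.

Lemma join_boxes i : tbox n (subdrawing D [:: i]) (l i) (r i) (d i) (u i).
Proof.
elim/ord3P: i; rewrite /l /r /d /u /at3 /=.
- have := tbox_translate (0, - q - 1 - uA) tA.
  by rewrite /= !addr0; congr tbox; lia.
- have := tbox_translate (- p - 1 - uB, 0) (tbox_swap (tbox_mirror tB)).
  by rewrite /= !addr0; congr tbox; lia.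
- have := tbox_translate (p + 1 + uB, 0) (tbox_mirror (tbox_swap tB)).
  by rewrite /= !addr0; congr tbox; lia.
Qed.

(** By [pq], the box of the child below is separated from the side boxes by columns if [sA <= p] and
    by rows if [sB <= q]. *)
Lemma join_good : good n.+1 D.
Proof.
have := tbox_root n0 tA; have := tbox_root n0 tB; rewrite A0 B0 /= => -[b1 b2 b3 b4] [a1 a2 a3 a4].
have E0 : D [:: @Ordinal 3 0 isT] = (0, - q - 1 - uA).
  by rewrite /D /= A0 /translate /=; congr pair; lia.
have E1 : D [:: @Ordinal 3 1 isT] = (- p - 1 - uB, 0).
  by rewrite /D /= B0 /translate /=; congr pair; lia.
have E2 : D [:: @Ordinal 3 2 isT] = (p + 1 + uB, 0).
  by rewrite /D /= B0 /translate /=; congr pair; lia.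
apply: (good_join n0 _ join_boxes).
- elim/ord3P.
  + exact: (good_translate (0, - q - 1 - uA) gA).
  + exact: (good_translate (- p - 1 - uB, 0) (good_swap (good_mirror gB))).
  + exact: (good_translate (p + 1 + uB, 0) (good_mirror (good_swap gB))).
- elim/ord3P; elim/ord3P => //; rewrite /l /r /d /u /at3 /=; lia.
- by elim/ord3P; rewrite ?E0 ?E1 ?E2 /aligned /=; lia.
- by elim/ord3P; elim/ord3P => // z _; rewrite ?E0 ?E1 ?E2 /onseg /l /r /d /u /at3 /=; lia.
- elim/ord3P; elim/ord3P => // -[z1 z2] _; rewrite ?E0 ?E1 ?E2 /onseg /= => H1 H2;
    congr pair; lia.
- elim/ord3P => v j [z1 z2] sv; rewrite ?E0 ?E1 ?E2 => H1 H2.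
  (* The point is pulled back to the coordinates of [A], and in the other cases of [B], where the
     edge from the root arrives along the upward ray. *)
  + have [||| -> e] := @rA v j (z1, z2 + q + 1 + uA) sv.
    * by move: H2; rewrite /onseg /=; lia.
    * by move: H1; rewrite A0 /onseg /=; lia.
    * by move: H1; rewrite A0 /onseg /=; lia.
    by split=> //; move: e; rewrite A0 => -[e1 e2]; congr pair; lia.
  + have [||| -> e] := @rB v j (- z2, z1 + p + 1 + uB) sv.
    * by move: H2; rewrite /onseg /=; lia.
    * by move: H1; rewrite B0 /onseg /=; lia.
    * by move: H1; rewrite B0 /onseg /=; lia.
    by split=> //; move: e; rewrite B0 => -[e1 e2]; congr pair; lia.
  + have [||| -> e] := @rB v j (z2, p + 1 + uB - z1) sv.
    * by move: H2; rewrite /onseg /=; lia.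
    * by move: H1; rewrite B0 /onseg /=; lia.
    * by move: H1; rewrite B0 /onseg /=; lia.
    by split=> //; move: e; rewrite B0 => -[e1 e2]; congr pair; lia.
Qed.

Lemma join_ray : ray_free n.+1 D.
Proof.
have := tbox_root n0 tA; have := tbox_root n0 tB; rewrite A0 B0 /= => -[b1 b2 b3 b4] [a1 a2 a3 a4].
case=> [|k v] i [z1 z2] /= sv H /= e1 e2.
  split=> //; rewrite e1; congr pair; move: H; rewrite e1.
  by elim/ord3P: i => /=; rewrite ?A0 ?B0 /onseg /=; lia.
have := join_boxes k => -[/(_ v (ltnW sv)) + _ _].
have := join_boxes k => -[/(_ (rcons v i)) + _ _].
rewrite size_rcons => /(_ sv); rewrite /subdrawing /= => b b'.
move: H b b'; rewrite /onseg e1 /= /l /r /d /u.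
by elim/ord3P: k; rewrite /at3 /=; lia.
Qed.

Lemma join_tbox (s d' : int) : s = Order.max sA (p + 1 + (uB - dB)) ->
  d' = Order.min (- q - 1 - (uA - dA)) (- sB) -> tbox n.+1 D (- s) s d' sB.
Proof.
have := tbox_root n0 tA; have := tbox_root n0 tB; rewrite A0 B0 /= => -[b1 b2 b3 b4] [a1 a2 a3 a4].
move=> es ed; apply: (tbox_join join_boxes).
- by rewrite /=; lia.
- by elim/ord3P; rewrite /l /r /d /u /at3 /=; lia.
- have [h|h] : - s = - sA \/ - s = - p - 1 - (uB - dB) by lia.
    by exists (@Ordinal 3 0 isT).
  by exists (@Ordinal 3 1 isT).
- have [h|h] : s = sA \/ s = p + 1 + (uB - dB) by lia.
    by exists (@Ordinal 3 0 isT).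
  by exists (@Ordinal 3 2 isT).
- have [h|h] : d' = - q - 1 - (uA - dA) \/ d' = - sB by lia.
    by exists (@Ordinal 3 0 isT).
  by exists (@Ordinal 3 1 isT).
- by exists (@Ordinal 3 1 isT).
Qed.

Lemma join_drawing12 (R : realType) : drawing12 R n A -> drawing12 R n B ->
  (p = sA /\ q = 0) \/ (p = 0 /\ q = sB) -> drawing12 R n.+1 D.
Proof.
move=> wA wB pq'.
apply: (@Drawing12_combine R n D A B B (@Ordinal 3 0 isT) (@Ordinal 3 1 isT) (@Ordinal 3 2 isT))
  => //.
- by exists (0, - q - 1 - uA).
(* The maps [swap \o mirror] and [mirror \o swap] are the clockwise and counterclockwise quarter
   turns, so only the translations remain to be given. *)
- by exists (- p - 1 - uB, 0).
- by exists (p + 1 + uB, 0).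
have tb0 := join_boxes (@Ordinal 3 0 isT).
have tb1 := join_boxes (@Ordinal 3 1 isT).
have tb2 := join_boxes (@Ordinal 3 2 isT).
have := tbox_root n0 tA; have := tbox_root n0 tB; rewrite A0 B0 /= => -[b1 b2 b3 b4] [a1 a2 a3 a4].
have e0 : (subdrawing D [:: @Ordinal 3 0 isT] [::]).1 = 0.
  by rewrite /subdrawing /= A0 /=; lia.
have e1 : (subdrawing D [:: @Ordinal 3 1 isT] [::]).2 = 0.
  by rewrite /subdrawing /= B0 /=; lia.
have e2 : (subdrawing D [:: @Ordinal 3 2 isT] [::]).2 = 0.
  by rewrite /subdrawing /= B0 /=; lia.
rewrite /l /r /d /u /at3 /= in tb0 tb1 tb2.
rewrite /construction1 /construction2 e0 e1 e2.
rewrite (grid_rows_tbox R tb0) (grid_rows_tbox R tb1) (grid_rows_tbox R tb2).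
rewrite (grid_columns_tbox R tb0) (grid_columns_tbox R tb1) (grid_columns_tbox R tb2).
case: pq' => -[ep eq]; [left|right].
- split; split=> //.
  + by apply: is_max_interval => /=; lia.
  + by exists (- sA); [apply: is_min_interval|apply: is_max_interval]; lia.
  + by exists sA; [apply: is_max_interval|apply: is_min_interval]; lia.
- split; split=> //.
  + by apply: is_max_interval => /=; lia.
  + by apply: is_min_interval => /=; lia.
  + exists (- sB); last by apply: is_max_interval; lia.
    by rewrite setUid; apply: is_min_interval; lia.
Qed.
End Join.

Lemma ach_gt0 n s h : ach n s h -> (0 < n)%N.
Proof. by case. Qed.

(** The root at the origin, the box symmetric about its column and the free upward ray are what the
    gluing lemmas require of both ingredients. *)
Lemma ach_drawing (R : realType) n s h : ach n s h -> exists D d u,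
  [/\ drawing12 R n D, good n D, ray_free n D, D [::] = (0, 0)
    & tbox n D (- s%:Z) s%:Z d u /\ h%:Z = u - d + 1].
Proof.
elim=> [|{}n sA hA sB hB aA IA _ IB|{}n sA hA sB hB aA IA _ IB].
- exists (fun=> (0, 0)), 0, 0; split=> //; first exact: Drawing12_single.
  + by split=> //; case=> [|? ?] [|? ?].
  + by split; [exact: (tbox1 (fun=> (0, 0)))|].
- have [A [dA [uA [wA gA rA A0 [tA eA]]]]] := IA.
  have [B [dB [uB [wB gB rB B0 [tB eB]]]]] := IB.
  have n0 := ach_gt0 aA.
  have p0 : 0 <= sA%:Z by []. have q0 : 0 <= 0 :> int by [].
  have pq : sA%:Z <= sA%:Z \/ sB%:Z <= 0 by left.
  exists (join A B sA 0 uA uB), (Order.min (- 0 - 1 - (uA - dA)) (- sB%:Z)), sB%:Z; split=> //.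
  + exact: (join_drawing12 n0 A0 B0 tA tB p0 q0 pq wA wB (or_introl (conj erefl erefl))).
  + exact: (join_good n0 gA gB rA rB A0 B0 tA tB p0 q0 pq).
  + exact: (join_ray n0 A0 B0 tA tB p0 q0 pq).
  + split; last by lia.
    by apply: (join_tbox n0 A0 B0 tA tB p0 q0 pq); lia.
- have [A [dA [uA [wA gA rA A0 [tA eA]]]]] := IA.
  have [B [dB [uB [wB gB rB B0 [tB eB]]]]] := IB.
  have n0 := ach_gt0 aA.
  have q0 : 0 <= sB%:Z by []. have p0 : 0 <= 0 :> int by [].
  have pq : sA%:Z <= 0 \/ sB%:Z <= sB%:Z by right.
  exists (join A B 0 sB uA uB), (Order.min (- sB%:Z - 1 - (uA - dA)) (- sB%:Z)), sB%:Z; split=> //.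
  + exact: (join_drawing12 n0 A0 B0 tA tB p0 q0 pq wA wB (or_intror (conj erefl erefl))).
  + exact: (join_good n0 gA gB rA rB A0 B0 tA tB p0 q0 pq).
  + exact: (join_ray n0 A0 B0 tA tB p0 q0 pq).
  + have := tbox_root n0 tA; rewrite A0 /= => -[? ? ? ?].
    split; last by lia.
    by apply: (join_tbox n0 A0 B0 tA tB p0 q0 pq); lia.
Qed.

Lemma ach_ex n : (0 < n)%N -> exists s h, ach n s h.
Proof.
elim: n => // -[|n] IH _; first by exists 0%N, 1%N; exact: Ach1.
by have [s [h a]] := IH isT; eexists; eexists; exact: (AchNarrow a a).
Qed.

Theorem theorem4 (R : realType) (h : nat) (h_gt0 : (0 < h)%N) :
  exists D : drawing,
    [/\ drawing12 R h D,
        planar_orthogonal_grid_drawing R h D,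
        subtree_separation R h D
      & forall D' : drawing,
          planar_orthogonal_grid_drawing R h D' ->
          subtree_separation R h D' ->
          (area R h D <= area R h D')%N].
Proof.
(* The areas of the symmetric drawings form a nonempty set of natural numbers. Its minimum is
   realised by [ach_drawing], and [lower_area] finds a member at most the area of any competitor. *)
pose P k := `[< exists s t, ach h s t /\ k = ((2 * s + 1) * t)%N >].
have exP : exists k, P k.
  have [s [t a]] := ach_ex h_gt0.
  by exists ((2 * s + 1) * t)%N; apply/asboolP; exists s, t.
have [k /asboolP [s [t [a ek]]] min_k] := ex_minnP exP.
have [D [d [u [wD gD _ _ [tD eh]]]]] := ach_drawing R a.
have [plD sepD] := planar_of_good R gD.
exists D; split=> // D' plD' sepD'.
have gD' := good_of_planar plD' sepD'.
have [l' [r' [d' [u' tD']]]] := tbox_ex D' h_gt0.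
have [s' [t' [a' le']]] := lower_area h_gt0 gD' tD'.
have le_k : (k <= (2 * s' + 1) * t')%N by apply: min_k; apply/asboolP; exists s', t'.
have := area_tbox R h_gt0 tD; have := area_tbox R h_gt0 tD'.
rewrite -eh => e e'; rewrite -lez_nat e e'.
apply: le_trans le'.
have -> : s%:Z - - s%:Z + 1 = (2 * s + 1)%:Z by lia.
by rewrite -PoszM -ek lez_nat.
Qed.
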